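(* Let $T\colon X\to X$ be a continuous map on a compact metric space and let $\phi\colon X\to\mathbb{R}$ be a continuous function such that $(T,\phi)$ is a $C^r$ regular pair. Let $A=\inf_{\mu\in\mathcal{M}}\int_X\phi\,d\mu$ and $B=\sup_{\mu\in\mathcal{M}}\int_X\phi\,d\mu$, and let $F\colon[A,B]\to\mathbb{R}$ be a concave $C^r$ function. Then there exists a unique equilibrium measure for $(F,\phi)$. Moreover, the equilibrium measure is ergodic.
   Context: $\mathcal{M}$ is the set of $T$-invariant Borel probability measures on $X$ with the weak$^*$ topology and $h_\mu(T)$ is the Kolmogorov–Sinai entropy. Set $L(\phi)=\left\{\int_X\phi\,d\mu:\mu\in\mathcal{M}\right\}=[A,B]$. An equilibrium measure for $(F,\phi)$ is a measure $\nu\in\mathcal{M}$ attaining the supremum $$\sup_{\mu\in\mathcal{M}}\left\{h_\mu(T)+F\left(\int_X\phi\,d\mu\right)\right\}.$$ The classical topological pressure of a continuous $\psi\colon X\to\mathbb{R}$ is denoted $P(\psi)$; it satisfies $P(\psi)=\sup_{\mu\in\mathcal{M}}\left(h_\mu(T)+\int_X\psi\,d\mu\right)$, and a classical equilibrium measure for $\psi$ is a $\mu\in\mathcal{M}$ attaining this supremum. The pair $(T,\phi)$ is $C^r$-regular (for some $2\le r\le\omega$, where $\omega$ refers to the analytic case) if: (i) each function in $\operatorname{span}\{\phi,1\}$ has a unique equilibrium measure with respect to the classical topological pressure; (ii) for each $z\in\operatorname{int}L(\phi)$ the map $q\mapsto P(q(\phi-z))$, $q\in\mathbb{R}$, is of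 class $C^r$, is strictly convex, and its second derivative is positive for each $q\in\mathbb{R}$; (iii) the entropy map $\mu\mapsto h_\mu(T)$ is upper semicontinuous on $\mathcal{M}$. *)

(* Defs.v *)
From HB Require Import structures.
From mathcomp Require Import all_boot all_order all_algebra.
From mathcomp Require Import all_classical all_reals all_analysis.

Set Implicit Arguments.
Unset Strict Implicit.
Unset Printing Implicit Defensive.

Import Order.TTheory GRing.Theory Num.Theory.
Import numFieldNormedType.Exports.

Local Open Scope classical_set_scope.
Local Open Scope ring_scope.

(* The library's measurable types are pointed, so the base point only records
   that the space is nonempty. *)
#[short(type="pmetricType")]
HB.structure Definition PMetric (K : numDomainType) :=
  {M of Pointed M & Metric K M}.

Definition borel {R : realType} (X : pmetricType R) :=
  g_sigma_algebraType (@open X).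

Record invariant_measure {R : realType} {X : pmetricType R} (T : X -> X) :=
  InvariantMeasure {
    im_measure :> probability (borel X) R;
    im_invariant : forall B : set (borel X), measurable B ->
      im_measure (T @^-1` B) = im_measure B }.

(* A measure of the library is a function on all subsets, constrained only on
   the measurable ones; hence equality of measures, and uniqueness, are to be
   understood on measurable sets rather than as Leibniz equality. *)
Definition same_measure {R : realType} {X : pmetricType R} (T : X -> X)
    (mu nu : invariant_measure T) : Prop :=
  forall B : set (borel X), measurable B -> mu B = nu B.

Definition ergodic {R : realType} {X : pmetricType R} (T : X -> X)
    (mu : invariant_measure T) : Prop :=
  forall B : set (borel X), measurable B -> T @^-1` B = B ->
    mu B = 0%E \/ mu B = 1%E.

Section WeakStar.
Context {R : realType} {X : pmetricType R} (T : X -> X).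

HB.instance Definition _ := gen_eqMixin (invariant_measure T).
HB.instance Definition _ := gen_choiceMixin (invariant_measure T).

Definition integrate_continuous (mu : invariant_measure T) :
    {ptws {f : X -> R | continuous f} -> R} :=
  fun f => \int[mu]_x (sval f x).

(* Weak* topology: the coarsest one making mu |-> \int f dmu continuous for
   every continuous f : X -> R. *)
HB.instance Definition _ := Topological.copy (invariant_measure T)
  (initial_topology integrate_continuous).

End WeakStar.

Section Entropy.
Context {R : realType} {X : pmetricType R} (T : X -> X).

(* Cells may be empty; they contribute 0 to the entropy since 0 * ln 0 = 0. *)
Definition is_partition (k : nat) (C : 'I_k -> set (borel X)) : Prop :=
  [/\ forall i, measurable (C i), trivIset setT C & \bigcup_i C i = setT].

Definition partition_entropy (mu : invariant_measure T) (I : finType)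
    (C : I -> set (borel X)) : R :=
  - \sum_(i : I) fine (mu (C i)) * ln (fine (mu (C i))).

Definition dynamical_join (k : nat) (C : 'I_k -> set (borel X)) (n : nat)
    (w : {ffun 'I_n -> 'I_k}) : set (borel X) :=
  [set x | forall j : 'I_n, C (w j) (iter j T x)].

Definition entropy_wrt (mu : invariant_measure T) (k : nat)
    (C : 'I_k -> set (borel X)) : R :=
  limn (fun n : nat => partition_entropy mu (@dynamical_join k C n) / n%:R).

Definition KS_entropy (mu : invariant_measure T) : \bar R :=
  ereal_sup [set h | exists k (C : 'I_k -> set (borel X)),
    is_partition C /\ h = (entropy_wrt mu C)%:E].

End Entropy.

Section Pressure.
Context {R : realType} {X : pmetricType R} (T : X -> X).

Definition bowen_dist (n : nat) (x y : X) : R :=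
  \big[Num.max/0]_(j < n) mdist (iter j T x) (iter j T y).

(* Finite sets suffice: separated sets in a compact space are finite. *)
Definition bowen_separated (n : nat) (eps : R) (E : seq X) : Prop :=
  uniq E /\
  forall x y, x \in E -> y \in E -> x != y -> eps < bowen_dist n x y.

Definition birkhoff_sum (psi : X -> R) (n : nat) (x : X) : R :=
  \sum_(j < n) psi (iter j T x).

Definition separated_sum (psi : X -> R) (n : nat) (eps : R) : \bar R :=
  ereal_sup [set s | exists E, bowen_separated n eps E /\
    s = (\sum_(x <- E) expR (birkhoff_sum psi n x))%:E].

Definition pressure_at_scale (psi : X -> R) (eps : R) : \bar R :=
  limn_esup (fun n : nat => ((n%:R)^-1%:E * lne (separated_sum psi n eps))%E).

Definition pressure (psi : X -> R) : \bar R :=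
  lim (pressure_at_scale psi eps @[eps --> 0^'+]).

End Pressure.

Section Equilibrium.
Context {R : realType} {X : pmetricType R} (T : X -> X).

Definition classical_equilibrium (psi : X -> R) (nu : invariant_measure T) :=
  (KS_entropy nu + (\int[nu]_x psi x)%:E =
   ereal_sup [set (KS_entropy mu + (\int[mu]_x psi x)%:E)%E
             | mu in [set: invariant_measure T]])%E.

Definition nonlinear_equilibrium (F : R -> R) (phi : X -> R)
    (nu : invariant_measure T) :=
  (KS_entropy nu + (F (\int[nu]_x phi x)%R)%:E =
   ereal_sup [set (KS_entropy mu + (F (\int[mu]_x phi x)%R)%:E)%E
             | mu in [set: invariant_measure T]])%E.

Definition integral_range (phi : X -> R) : set R :=
  [set \int[mu]_x phi x | mu in [set: invariant_measure T]].

End Equilibrium.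

Inductive smoothness := Cfinite of nat | Cinfty | Comega.

Definition at_least_two (r : smoothness) : Prop :=
  if r is Cfinite n then (2 <= n)%N else True.

Section Smoothness.
Context {R : realType}.

Definition Cn_on (n : nat) (U : set R) (g : R -> R) : Prop :=
  (forall k x, (k < n)%N -> U x -> derivable (derive1n k g) x 1) /\
  (forall x, U x -> {for x, continuous (derive1n n g)}).

Definition analytic_on (U : set R) (g : R -> R) : Prop :=
  forall x, U x -> exists (a : nat -> R) (rho : R), 0 < rho /\
    forall y, `|y - x| < rho ->
      series (fun k => a k * (y - x) ^+ k) @ \oo --> g y.

(* To be used on open sets only. *)
Definition smooth_on (r : smoothness) (U : set R) (g : R -> R) : Prop :=
  match r with
  | Cfinite n => Cn_on n U g
  | Cinfty => forall n, Cn_on n U g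
  | Comega => analytic_on U g
  end.

(* On a compact interval, C^r means being the restriction of a C^r function
   defined on an open neighbourhood; only the values of F on [A, B] matter. *)
Definition smooth_on_itv (r : smoothness) (A B : R) (F : R -> R) : Prop :=
  exists (d : R) (G : R -> R), 0 < d /\
    smooth_on r [set` `]A - d, B + d[] G /\ {in `[A, B], G =1 F}.

Definition concave_on_itv (A B : R) (F : R -> R) : Prop :=
  convex_function (`[A, B]%classic : set R) (fun x : R => - F x).

Definition strictly_convex (g : R -> R) : Prop :=
  forall x y t, x != y -> 0 < t -> t < 1 ->
    g (t * x + (1 - t) * y) < t * g x + (1 - t) * g y.

End Smoothness.

Section RegularPair.
Context {R : realType} {X : pmetricType R} (T : X -> X).

Definition regular_pair (r : smoothness) (phi : X -> R) : Prop :=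
  [/\ forall a b : R,
        let psi := fun x => a * phi x + b in
        exists nu : invariant_measure T, classical_equilibrium psi nu /\
          forall nu', classical_equilibrium psi nu' -> same_measure nu' nu,
      forall z, (integral_range T phi)° z ->
        let p := fun q : R => pressure T (fun x => q * (phi x - z)) in
        (forall q, p q \is a fin_num) /\
        let g := fun q => fine (p q) in
        [/\ smooth_on r setT g, strictly_convex g &
            forall q, 0 < derive1n 2 g q]
    & lower_semicontinuous (fun mu : invariant_measure T => - KS_entropy mu)%E].

End RegularPair.

(* Main.v *)
(** Let [I mu] be the integral of [phi] and [m q] the unique classical
    equilibrium measure of [q * phi].  If [q] is a supergradient of [F] at
    [I (m q)], then for every invariant [mu],
      [h mu + F (I mu) <= h mu + F (I (m q)) + q * (I mu - I (m q))
                       <= h (m q) + F (I (m q))],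
    so [m q] is a nonlinear equilibrium, and equality forces [mu] to be a
    classical equilibrium of [q * phi], that is [mu = m q].  Such a [q] exists
    because [q |-> I (m q)] is continuous (upper semicontinuity of the entropy,
    weak* compactness, uniqueness of [m q]) and [F] is [K]-Lipschitz and concave:
    the [q] for which the supergradient inequality holds to the right of
    [I (m q)] and those for which it holds to the left form two closed nonempty
    sets covering the interval from [-K] to [K], which is connected.  Ergodicity
    holds because entropy is a convex function of the measure, so that the two
    conditional measures of an invariant set cannot both fail to be equilibria. *)

Require Import Defs.
From HB Require Import structures.
From mathcomp Require Import all_boot all_order all_algebra.
From mathcomp Require Import all_classical all_reals all_analysis.
From mathcomp Require Import measurable_realfun ring lra.

Set Implicit Arguments.
Unset Strict Implicit.
Unset Printing Implicit Defensive.

Import Order.TTheory GRing.Theory Num.Theory.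
Import numFieldNormedType.Exports.

Local Open Scope classical_set_scope.
Local Open Scope ring_scope.

(** * From finitely additive contents to Borel probabilities *)

Section ContentToMeasure.
Context {R : realType} {X : pmetricType R}.
Hypothesis hX : compact [set: X].
Variable m : set (borel X) -> R.
Hypothesis m_ge0 : forall E, measurable E -> 0 <= m E.
Hypothesis m_add : forall E F, measurable E -> measurable F ->
  E `&` F = set0 -> m (E `|` F) = m E + m F.
Hypothesis m_setT : m setT = 1.

Lemma open_borel (U : set X) : open U -> measurable (U : set (borel X)).
Proof. exact: sub_sigma_algebra. Qed.

Lemma closed_borel (K : set X) : closed K -> measurable (K : set (borel X)).
Proof.
move=> cK; rewrite -(setCK K).
apply: (@measurableC _ (borel X)).
by apply: open_borel; exact: closed_openC.
Qed.

Lemma content_le (E F : set (borel X)) :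
  measurable E -> measurable F -> E `<=` F -> m E <= m F.
Proof.
move=> mE mF EF; have mFE := measurableD mF mE.
by rewrite -(setDUK EF) m_add ?lerDl ?setDIK ?m_ge0.
Qed.

(* The content need not be regular on all Borel sets, but its inner regularization
   on open sets is countably subadditive by compactness. *)
Definition inner_content (U : set X) : \bar R :=
  ereal_sup [set (m K)%:E | K in [set K : set X | closed K /\ K `<=` U]].

Definition outer_content (E : set X) : \bar R :=
  ereal_inf [set inner_content U | U in [set U | open U /\ E `<=` U]].

Local Open Scope ereal_scope.

Lemma le_inner_content (K U : set X) : closed K -> K `<=` U ->
  (m K)%:E <= inner_content U.
Proof. by move=> cK KU; apply: ereal_sup_ubound; exists K. Qed.

Lemma inner_content_ge0 U : 0 <= inner_content U.
Proof.
apply: le_trans (le_inner_content closed0 (@sub0set _ U)).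
by rewrite lee_fin m_ge0.
Qed.

Lemma inner_content_mono U V : U `<=` V -> inner_content U <= inner_content V.
Proof.
move=> UV; apply: ge_ereal_sup => _ [K [cK KU] <-].
by apply: le_inner_content => //; exact: subset_trans UV.
Qed.

Lemma inner_content_open_le U : open U -> inner_content U <= (m U)%:E.
Proof.
move=> oU; apply: ge_ereal_sup => _ [K [cK KU] <-]; rewrite lee_fin.
by apply: content_le => //; [exact: closed_borel|exact: open_borel].
Qed.

Lemma outer_content_open U : open U -> outer_content U = inner_content U.
Proof.
move=> oU; apply/eqP; rewrite eq_le; apply/andP; split.
  by apply: ereal_inf_lbound; exists U => //; split.
by apply: le_ereal_inf_tmp => _ [V [oV UV] <-]; exact: inner_content_mono.
Qed.

Lemma outer_content_le E U : open U -> E `<=` U ->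
  outer_content E <= inner_content U.
Proof. by move=> oU EU; apply: ereal_inf_lbound; exists U. Qed.

Lemma outer_content_ge0 E : 0 <= outer_content E.
Proof. by apply: le_ereal_inf_tmp => _ [V _ <-]; exact: inner_content_ge0. Qed.

Lemma outer_content_fin E : outer_content E \is a fin_num.
Proof.
rewrite ge0_fin_numE ?outer_content_ge0//.
apply: le_lt_trans (outer_content_le openT (@subsetT _ E)) _.
by apply: le_lt_trans (inner_content_open_le openT) _; rewrite ltry.
Qed.

(** Induction on [n]: normality of the space divides a closed [K] between the last open set and the
    union of the earlier ones. *)
Lemma content_bigsetU_le n (F : nat -> set X) (K : set X) :
  (forall i, open (F i)) -> closed K -> K `<=` \big[setU/set0]_(i < n) F i ->
  (m K)%:E <= \sum_(i < n) inner_content (F i).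
Proof.
move=> oF; elim: n K => [|n IH] K cK; rewrite ?big_ord0 ?big_ord_recr/=.
  rewrite subset0 => ->.
  have := @m_add set0 set0 measurable0 measurable0 (set0I _).
  by rewrite setU0 => /eqP; rewrite -subr_eq0 opprD addNKr oppr_eq0 => /eqP ->.
set G := \big[setU/set0]_(i < n) F i => KGF.
have oG : open G by apply: big_ind => //; [exact: open0|exact: openU].
have closedD (C O : set X) : closed C -> open O -> closed (C `\` O).
  by move=> cC oO; rewrite setDE; apply: closedI => //; exact: open_closedC.
(* K \ G and K \ F n are disjoint closed sets; separating them splits K into two
   closed pieces, one inside G and one inside F n. *)
have [U [V [oU oV KU KV UV0]]] : exists U V, [/\ open U, open V,
    K `\` G `<=` U, K `\` F n `<=` V & U `&` V = set0].
  apply/(@normal_openP R X).1; first exact: (@pseudometric_normal R).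
  - by apply: closedD.
  - by apply: closedD.
  - by apply/seteqP; split => // x [[Kx nG] [_ nF]]; have [] := KGF x Kx.
have {1}-> : K = (K `\` U) `|` (K `\` V).
  by rewrite -setDIr UV0 setD0.
have cKU : closed (K `\` U) by apply: closedD.
have cKV : closed (K `\` V) by apply: closedD.
apply: (@le_trans _ _ ((m (K `\` U))%:E + (m (K `\` V))%:E)).
  rewrite -EFinD lee_fin.
  (* The two pieces may overlap, whereas [m] is additive on disjoint sets only. The second piece is
     trimmed, then enlarged again by monotonicity. *)
  have -> : (K `\` U `|` K `\` V = K `\` U `|` ((K `\` V) `\` (K `\` U)))%classic.
    apply/seteqP; split=> x [] xK; [by left| |by left|by right; case: xK].
    by have [xU|nxU] := pselect ((K `\` U) x); [left|right].
  rewrite m_add ?setDIK//; last 2 first.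
  - exact: closed_borel.
  - by apply: measurableD; exact: closed_borel.
  rewrite lerD2l content_le//.
  - by apply: measurableD; exact: closed_borel.
  - exact: closed_borel.
apply: leeD.
  apply: IH => // x [Kx nUx]; apply: contrapT => nGx; apply: nUx.
  by apply: KU.
apply: le_inner_content => // x [Kx nVx]; apply: contrapT => nFx.
by apply: nVx; apply: KV.
Qed.

(** A closed [K] in the union is compact, so finitely many of the [F i] cover it; [n] exceeds all
    their indices. *)
Lemma inner_content_bigcup (F : nat -> set X) : (forall i, open (F i)) ->
  inner_content (\bigcup_i F i) <= \sum_(i <oo) inner_content (F i).
Proof.
move=> oF; apply: ge_ereal_sup => _ [K [cK KF] <-].
have : compact K by apply: (subclosed_compact cK hX).
rewrite compact_cover => /(_ _ setT F (fun i _ => oF i) KF) [D _ KD].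
pose n := (\max_(i <- finmap.enum_fset D) i).+1.
apply: le_trans (content_bigsetU_le (n := n) oF cK _) _.
  move=> x /KD [i /= iD Fix]; rewrite -bigcup_mkord; exists i => //=.
  by rewrite ltnS; exact: leq_bigmax_seq.
rewrite -(big_mkord xpredT (fun i => inner_content (F i))).
by apply: nneseries_lim_ge => i _ _; exact: inner_content_ge0.
Qed.

Lemma outer_content_set0 : outer_content set0 = 0.
Proof.
rewrite outer_content_open; last exact: open0.
apply/eqP; rewrite eq_le inner_content_ge0 andbT.
have := @content_bigsetU_le 0 (fun=> set0) set0 (fun=> open0) closed0.
rewrite !big_ord0 => /(_ (@subset_refl _ _)) h.
by apply: le_trans (inner_content_open_le open0) h.
Qed.

Lemma outer_content_mono : {homo outer_content : E F / E `<=` F >-> E <= F}.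
Proof.
move=> E F EF; apply: le_ereal_inf_tmp => _ [U [oU FU] <-].
by apply: outer_content_le => //; exact: subset_trans FU.
Qed.

Lemma outer_content_sigma_subadditive : sigma_subadditive outer_content.
Proof.
move=> F; apply/lee_addgt0Pr => e e0.
rewrite (le_trans _ (epsilon_trick _ _ _))//; last 2 first.
- by move=> n; exact: outer_content_ge0.
- exact: ltW.
have /choice[G PG] n : exists U, [/\ open U, F n `<=` U &
    inner_content U <= outer_content (F n) + (e / (2 ^ n.+1)%:R)%:E].
  have en : (0 < e / (2 ^ n.+1)%:R)%R by rewrite divr_gt0// ltr0n expn_gt0.
  have [_ [U [oU FU] <-] h] := lb_ereal_inf_adherent en (outer_content_fin (F n)).
  by exists U; split => //; exact: ltW.
have oG n : open (G n) by have [] := PG n.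
apply: (@le_trans _ _ (inner_content (\bigcup_n G n))).
  apply: outer_content_le; first exact: bigcup_open.
  by apply: subset_bigcup => i _; have [] := PG i.
apply: le_trans (inner_content_bigcup oG) _.
apply: lee_nneseries => [i _ _|i _]; first exact: inner_content_ge0.
by have [] := PG i.
Qed.

HB.instance Definition _ := isOuterMeasure.Build R X outer_content
  outer_content_set0 outer_content_ge0 outer_content_mono
  outer_content_sigma_subadditive.

(** It suffices to split an open [U] containing [E]. If [K] is closed in [U] and [W], and [L] is
    closed in [U] minus [K], then [K] and [L] are disjoint and [m L + m K] is at most the inner
    content of [U]; the suprema over [L], then over [K], give the inequality. *)
Lemma content_caratheodory_open W : open W -> outer_content.-caratheodory W.
Proof.
move=> oW; apply: le_caratheodory_measurable => E.
apply: le_ereal_inf_tmp => _ [U [oU EU] <-].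
apply: (@le_trans _ _ (inner_content (U `&` W) + outer_content (U `&` ~` W))).
  apply: leeD; last by apply: outer_content_mono; exact: setSI.
  by apply: outer_content_le; [exact: openI|exact: setSI].
rewrite -leeBrDr ?outer_content_fin//.
apply: ge_ereal_sup => _ [K [cK KUW] <-].
rewrite leeBrDr ?outer_content_fin// addeC -leeBrDr//.
have oUK : open (U `\` K) by rewrite setDE; apply: openI => //; exact: closed_openC.
apply: (@le_trans _ _ (inner_content (U `\` K))).
  by apply: outer_content_le => // x [Ux nWx]; split => // /KUW[].
apply: ge_ereal_sup => _ [L [cL LUK] <-].
rewrite leeBrDr// -EFinD -m_add; last 3 first.
- exact: closed_borel.
- exact: closed_borel.
- by apply/seteqP; split => // x [/LUK[]].
apply: le_inner_content; first exact: closedU.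
by move=> x [/LUK[]|/KUW[]].
Qed.

Let borel_caratheodory (E : set (borel X)) :
  measurable E -> outer_content.-cara.-measurable E.
Proof.
apply: smallest_sub; last by move=> U; exact: content_caratheodory_open.
split; [exact: measurable0|by move=> A; rewrite setTD; exact: measurableC|].
by move=> F mF; apply: bigcupT_measurable.
Qed.

(** Carathéodory measurability passes from open sets to all Borel sets. [P] may differ from [m], but
    every open set around a closed [K] has [K] as a competitor in its inner content, whence
    [m K <= P K]. This bound is the portmanteau condition for weak limits. *)
Lemma content_to_probability : exists P : probability (borel X) R,
  (forall U : set X, open U -> P U = inner_content U) /\
  (forall K : set X, closed K -> (m K)%:E <= P K).
Proof.
pose P0 := outer_content : set (borel X) -> \bar R.
have P0sa : semi_sigma_additive P0.
  move=> F mF tF mUF.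
  by apply: (@caratheodory_measure_sigma_additive R X outer_content) => //;
    [move=> i|]; exact: borel_caratheodory.
pose P1 : {measure set (borel X) -> \bar R} := HB.pack P0
  (isMeasure.Build _ _ _ P0 outer_content_set0 outer_content_ge0 P0sa).
have P1T : P1 setT = 1.
  rewrite /P1/= /P0 outer_content_open; last exact: openT.
  apply/eqP; rewrite eq_le (le_trans (inner_content_open_le openT)) ?m_setT//=.
  have := @le_inner_content setT setT closedT (@subset_refl _ _).
  by rewrite m_setT.
pose P : probability (borel X) R := HB.pack (P1 : set _ -> _) P1
  (Measure_isProbability.Build _ _ _ P1 P1T).
exists P; split=> [U oU|K cK]; rewrite /P/= /P0; first exact: outer_content_open.
by apply: le_ereal_inf_tmp => _ [U [oU KU] <-]; exact: le_inner_content.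
Qed.

End ContentToMeasure.

(** * Weak limits along ultrafilters *)

Lemma cvg_ord_sum {R : realType} (I : Type) (U : set_system I)
    {FU : Filter U} (n : nat) (f : nat -> I -> R) (l : nat -> R) :
  (forall k, f k @ U --> l k) ->
  (fun i => \sum_(k < n) f k i) @ U --> \sum_(k < n) l k.
Proof.
move=> fl; elim: n => [|n IH].
  by under eq_fun do rewrite big_ord0; rewrite big_ord0; exact: cvg_cst.
under eq_fun do rewrite big_ord_recr/=.
by rewrite big_ord_recr/=; apply: cvgD.
Qed.

Lemma ler_fmap_cvg {R : realType} (I : Type) (U : set_system I)
    {FU : ProperFilter U} (f g : I -> R) (l l' : R) :
  f @ U --> l -> g @ U --> l' -> (forall i, f i <= g i) -> l <= l'.
Proof.
move=> fl gl fg; rewrite -subr_ge0.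
apply: (cvgr_to_ge (cvgB gl fl)); apply: nearW => i.
by rewrite subr_ge0.
Qed.

Lemma Rintegral_cst_probability d (T : measurableType d) {R : realType}
  (P : probability T R) (r : R) : \int[P]_x r = r.
Proof. by rewrite Rintegral_cst//= probability_setT mulr1. Qed.

Lemma fine_probability_bounds d (T : measurableType d) {R : realType}
  (P : probability T R) (A : set T) : measurable A -> 0 <= fine (P A) <= 1.
Proof.
move=> mA; rewrite fine_ge0//= -[leRHS]/(fine (1%:E)) fine_le//.
  exact: fin_num_measure.
exact: probability_le1.
Qed.

Lemma bounded_integrable d (T : measurableType d) {R : realType}
    (P : probability T R) (f : T -> R) C :
  measurable_fun setT f -> (forall x, `|f x| <= C) ->
  P.-integrable setT (EFin \o f).
Proof.
move=> mf fC; apply: measurable_bounded_integrable => //.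
  by apply: (le_lt_trans (probability_le1 P measurableT)); rewrite ltry.
exists C; split; first exact: num_real.
by move=> D CD x _ /=; exact: le_trans (fC x) (ltW CD).
Qed.

(** Compactness of [[a, b]] yields a cluster point, and a cluster point of an ultrafilter is a
    limit: a set or its complement belongs to the ultrafilter. *)
Lemma ultra_bounded_cvg {R : realType} (I : Type) (U : set_system I)
    (f : I -> R) (a b : R) : UltraFilter U -> (forall i, a <= f i <= b) ->
  exists2 l, f @ U --> l & a <= l <= b.
Proof.
move=> UU fab; have ab := segment_compact (a := a) (b := b).
have [|l [lab cl]] := ab (f @ U) _.
  suff : U (f @^-1` `[a, b]%classic) by [].
  by apply: (@filterS _ U _ setT) filterT => i _ /=; rewrite in_itv/= fab.
exists l; last by move: lab; rewrite /= in_itv.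
move=> V Vl; have [//|nV] := in_ultra_setVsetC (f @^-1` V) UU.
by have [y [/= nVy Vy]] := cl (~` V) V nV Vl.
Qed.

Section WeakLimits.
Context {R : realType} {X : pmetricType R}.
Hypothesis hX : compact [set: X].
Implicit Types (f : X -> R) (P : probability (borel X) R).

Lemma continuous_borel_fun f : continuous f -> measurable_fun [set: borel X] f.
Proof.
move=> cf; apply: (measurability _ (RGenOpens.measurableE R)).
move=> _ [_ [a [b ->] <-]]; rewrite setTI; apply: open_borel.
by apply: open_comp => // x _; exact: cf.
Qed.

Lemma continuous_bounded f : continuous f ->
  exists2 C, 0 < C & forall x, `|f x| <= C.
Proof.
move=> cf; have : compact (f @` setT).
  by apply: continuous_compact => //; exact: continuous_subspaceT.
move=> /compact_bounded[M [_ hM]]; exists (`|M| + 1); first exact: ltr_wpDl.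
by move=> x; apply: (hM (`|M| + 1)); [rewrite (le_lt_trans (ler_norm M))// ltrDl|exists x].
Qed.

Lemma continuous_integrable P f : continuous f ->
  P.-integrable [set: borel X] (EFin \o f).
Proof.
move=> cf; have [C _ fC] := continuous_bounded cf.
exact: bounded_integrable (continuous_borel_fun cf) fC.
Qed.

Lemma indic_set (T : Type) (p : pred T) (y : T) :
  \1_[set z | p z] y = (p y)%:R :> R.
Proof.
rewrite indicE; congr ((nat_of_bool _)%:R).
by apply/idP/idP; rewrite inE.
Qed.

Lemma Rintegral_norm_le P f C : continuous f -> (forall x, `|f x| <= C) ->
  `|\int[P]_x f x| <= C.
Proof.
move=> cf fC; have fi := continuous_integrable P cf.
apply: le_trans (le_normr_Rintegral measurableT fi) _.
rewrite -[leRHS](Rintegral_cst_probability P).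
apply: le_Rintegral => //.
- by apply: (@continuous_integrable P (fun x => `|f x|)) => x;
    apply: cvg_norm; exact: cf.
- by apply: (@continuous_integrable P (cst C)) => x; exact: cvg_cst.
Qed.

(* Layer-cake staircase: the integral of [levels N \o f] is a sum of measures of
   the closed sets [f >= k + 1], on which weak limits are controlled. *)
Definition levels (N : nat) (y : R) : R :=
  \sum_(k < N) \1_[set z | k.+1%:R <= z] y.

(** On [[0, N]] the staircase is the integer part. *)
Lemma levels_bounds N y : 0 <= y <= N%:R -> levels N y <= y <= levels N y + 1.
Proof.
move=> /andP[y0]; elim: N => [|N IH] yN; rewrite /levels.
  by rewrite big_ord0 y0 add0r (le_trans yN)// ler01.
rewrite big_ord_recr/= -/(levels N y) indic_set.
have [yN'|Ny] := leP y N%:R.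
  have /IH/andP[h1 h2] := yN'.
  have -> : (N.+1%:R <= y) = false by apply/negP => Sy; move: Sy; rewrite -natr1; lra.
  by rewrite /= addr0 h1.
have -> : levels N y = N%:R.
  rewrite /levels (eq_bigr (fun=> 1)) ?sumr_const ?card_ord// => k _.
  rewrite indic_set (_ : _ <= y)//.
  by rewrite (le_trans _ (ltW Ny))// ler_nat.
move: yN; rewrite -natr1 => yN; case: (leP (N%:R + 1) y) => /= h; lra.
Qed.

Lemma integral_levels P (f : borel X -> R) N : measurable_fun setT f ->
  P.-integrable setT (EFin \o (levels N \o f)) /\
  \int[P]_x levels N (f x) = \sum_(k < N) fine (P [set x | k.+1%:R <= f x]).
Proof.
move=> mf; have mA (k : nat) : measurable [set x | k.+1%:R <= f x].
  rewrite [X in measurable X](_ : _ = setT `&` f @^-1` `[k.+1%:R, +oo[%classic).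
    by apply: mf => //; exact: measurable_itv.
  by rewrite setTI; apply/seteqP; split=> x /=; rewrite in_itv/= andbT.
elim: N => [|N [IHi IH]].
  split.
    apply: (eq_integrable measurableT (cst 0%E)); last exact: integrable0.
    by move=> x _; rewrite /= /levels big_ord0.
  rewrite big_ord0 -[RHS](@mul0r _ (fine (P setT))) -Rintegral_cst//.
  by apply: eq_Rintegral => x _; rewrite /levels big_ord0.
have iA : P.-integrable setT
    (EFin \o (\1_[set x | N.+1%:R <= f x] : borel X -> R)).
  exact: integrable_indic.
have E x : levels N.+1 (f x) = levels N (f x) + \1_[set x | N.+1%:R <= f x] x.
  by rewrite /levels big_ord_recr/= !indic_set.
split.
  apply: (eq_integrable measurableT (fun x => (levels N (f x))%:E
      + (\1_[set x | N.+1%:R <= f x] x)%:E)%E).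
    by move=> x _; rewrite /= E EFinD.
  exact: integrableD.
rewrite (@eq_Rintegral _ _ _ _ _ (fun x => levels N (f x) +
  \1_[set x | N.+1%:R <= f x] x)); last by move=> x _; exact: E.
rewrite RintegralD// IH big_ord_recr/=; congr (_ + _).
by rewrite /Rintegral integral_indic// setIT.
Qed.



(** Portmanteau argument. For [f] with values in [[0, 1]], the integral of [N * f] is within [1] of
    a sum of measures of closed sets; dividing by a large [N] bounds the limit by the integral
    against [P]. Rescaling covers every bounded [f], and applying the bound to [- f] gives
    equality. *)
Lemma ultra_integral_cvg (I : Type) (U : set_system I)
    (Q : I -> probability (borel X) R) P : UltraFilter U ->
  (forall K : set X, closed K ->
    forall l, (fun i => fine (Q i K)) @ U --> l -> l <= fine (P K)) ->
  forall f, continuous f ->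
    (fun i => \int[Q i]_x f x) @ U --> \int[P]_x f x.
Proof.
move=> UU QP.
have unit_le f l : continuous f -> (forall x, 0 <= f x <= 1) ->
    (fun i => \int[Q i]_x f x) @ U --> l -> l <= \int[P]_x f x.
  move=> cf f01 Ql.
  (* The slack [1] does not depend on [n], so a large [n] rules out a positive difference. *)
  suff le_n n : n.+1%:R * l <= n.+1%:R * \int[P]_x f x + 1.
    rewrite leNgt; apply/negP => Pl.
    have dl : 0 < l - \int[P]_x f x by rewrite subr_gt0.
    have := archi_boundP (ltW (divr_gt0 ltr01 dl)).
    set n := Num.bound _ => hn.
    have := le_n n; rewrite -lerBlDl -mulrBr -natr1.
    move: hn; rewrite ltr_pdivrMr// => hn; rewrite mulrDl mul1r; lra.
  pose N := n.+1; pose g : X -> R := fun x => N%:R * f x.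
  have cg : continuous g by move=> x; apply: cvgM; [exact: cvg_cst|exact: cf].
  have mg := continuous_borel_fun cg.
  have gN x : 0 <= g x <= N%:R.
    have /andP[f0 f1] := f01 x; rewrite /g mulr_ge0//=.
    by rewrite -[leRHS]mulr1 ler_wpM2l.
  have cA (k : nat) : closed [set x | k.+1%:R <= g x].
    rewrite -/(g @^-1` [set y | k.+1%:R <= y]).
    by apply: closed_comp => [x _|]; [exact: cg|exact: closed_ge].
  (* Along an ultrafilter the measures of the level sets converge without passing to a subfamily. *)
  have /choice[a aP] k : exists a : R,
      (fun i => fine (Q i [set x | k.+1%:R <= g x])) @ U --> a.
    have [|a] := @ultra_bounded_cvg R I U
      (fun i => fine (Q i [set x | k.+1%:R <= g x])) 0 1 UU.
      by move=> i; exact: fine_probability_bounds (closed_borel (cA k)).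
    by exists a.
  have intg (P' : probability (borel X) R) : \int[P']_x g x = N%:R * \int[P']_x f x.
    by rewrite RintegralZl//; exact: continuous_integrable.
  have i1 (P' : probability (borel X) R) :
      P'.-integrable setT (EFin \o (cst 1 : borel X -> R)).
    by apply: (@continuous_integrable P' (cst 1)) => x; exact: cvg_cst.
  have upper (P' : probability (borel X) R) : N%:R * \int[P']_x f x <=
      \sum_(k < N) fine (P' [set x | k.+1%:R <= g x]) + 1.
    have [iL <-] := integral_levels P' N mg.
    have <- : \int[P']_x (levels N (g x) + 1) = \int[P']_x levels N (g x) + 1.
      by rewrite (RintegralD _ iL (i1 P'))// Rintegral_cst_probability.
    rewrite -intg; apply: le_Rintegral => //.
    - exact: continuous_integrable.
    - exact: (integrableD _ iL (i1 P')).
    - by move=> x _; have /andP[] := levels_bounds (gN x).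
  have lower : \sum_(k < N) fine (P [set x | k.+1%:R <= g x]) <=
      N%:R * \int[P]_x f x.
    have [iL <-] := integral_levels P N mg.
    rewrite -intg; apply: le_Rintegral => //.
    - exact: continuous_integrable.
    - by move=> x _; have /andP[] := levels_bounds (gN x).
  apply: (@le_trans _ _ (\sum_(k < N) a k + 1)).
    apply: (@ler_fmap_cvg _ _ U _ (fun i => N%:R * \int[Q i]_x f x)
      (fun i => \sum_(k < N) fine (Q i [set x | k.+1%:R <= g x]) + 1)).
    - by apply: cvgM => //; exact: cvg_cst.
    - apply: cvgD; last exact: cvg_cst.
      apply: (@cvg_ord_sum _ _ U _ N (fun (k : nat) i =>
        fine (Q i [set x | k.+1%:R <= g x])) a) => k; exact: aP.
    - by move=> i; exact: upper.
  rewrite lerD2r (le_trans _ lower)// ler_sum// => k _.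
  exact: QP (cA k) _ (aP k).
have le_lim f l : continuous f ->
    (fun i => \int[Q i]_x f x) @ U --> l -> l <= \int[P]_x f x.
  move=> cf Ql; have [C C0 fC] := continuous_bounded cf.
  (* The affine map taking [[- C, C]] onto [[0, 1]]. *)
  pose g x := (2 * C)^-1 * (f x + C).
  have cfC : continuous (fun x => f x + C).
    by move=> x; apply: cvgD; [exact: cf|exact: cvg_cst].
  have cg : continuous g by move=> x; apply: cvgM; [exact: cvg_cst|exact: cfC].
  have intg (P' : probability (borel X) R) :
      \int[P']_x g x = (2 * C)^-1 * (\int[P']_x f x + C).
    rewrite RintegralZl//; last exact: continuous_integrable.
    rewrite RintegralD//; last 2 first.
    - exact: continuous_integrable.
    - by apply: (@continuous_integrable P' (cst C)) => x; exact: cvg_cst.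
    by rewrite Rintegral_cst_probability.
  have C2 : 0 < 2 * C by rewrite mulr_gt0.
  have := @unit_le g ((2 * C)^-1 * (l + C)) cg.
  rewrite intg ler_pM2l ?invr_gt0// lerD2r; apply.
    move=> x; rewrite /g mulrC ler_pdivrMr// ler_pdivlMr//.
    have := fC x; rewrite ler_norml; lra.
  under eq_fun do rewrite intg.
  by apply: cvgM; [exact: cvg_cst|apply: cvgD => //; exact: cvg_cst].
move=> f cf.
have [C C0 fC] := continuous_bounded cf.
have [|l Ql _] := @ultra_bounded_cvg R I U (fun i => \int[Q i]_x f x) (- C) C UU.
  by move=> i; rewrite -ler_norml; exact: Rintegral_norm_le.
suff <- : l = \int[P]_x f x by [].
apply/eqP; rewrite eq_le le_lim//=.
have intN (P' : probability (borel X) R) :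
    \int[P']_x (- f x) = - \int[P']_x f x.
  under eq_Rintegral do rewrite -mulN1r.
  by rewrite RintegralZl ?mulN1r//; exact: continuous_integrable.
rewrite -lerN2 -intN; apply: le_lim; first by move=> x; apply: cvgN; exact: cf.
by under eq_fun do rewrite intN; exact: cvgN.
Qed.

End WeakLimits.

(** * Weak* compactness of the invariant measures *)

Lemma continuous_borel_map {R : realType} {X : pmetricType R} (T : X -> X) :
  continuous T -> measurable_fun [set: borel X] (T : borel X -> borel X).
Proof.
move=> cT.
apply: (@measurability _ _ (borel X) (borel X) setT T (@open X)) => // _ [U oU <-].
by rewrite setTI; apply: open_borel; apply: open_comp => // x _; exact: cT.
Qed.

(** Open sets are stable under intersection and generate the Borel sets, so two finite measures that
    agree on them are equal. *)
Lemma pushforward_eq_on_open {R : realType} {X : pmetricType R} (T : X -> X)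
    (P : probability (borel X) R) : continuous T ->
  (forall U : set X, open U -> P (T @^-1` U) = P U) ->
  forall B : set (borel X), measurable B -> P (T @^-1` B) = P B.
Proof.
move=> cT PT.
have mT := continuous_borel_map cT.
pose Q : {measure set (borel X) -> \bar R} :=
  measure_function_pushforward__canonical__measure_function_Measure P mT.
move=> B mB; rewrite -[LHS]/(Q B).
apply: (@measure_unique _ R (borel X) (@open X) (fun=> setT) _ _ _ _ Q P) => //.
- by move=> A C; exact: openI.
- by move=> _; exact: openT.
- by rewrite bigcup_const.
- by move=> k; rewrite /Q/= /pushforward preimage_setT;
    apply: (le_lt_trans (probability_le1 P measurableT)); rewrite ltry.
Qed.

Section WeakStarCompactness.
Context {R : realType} {X : pmetricType R}.
Hypothesis hX : compact [set: X].
Variable T : X -> X.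
Hypothesis hT : continuous T.

Lemma weak_star_cvg (U : set_system (invariant_measure T))
    (nu : invariant_measure T) : Filter U ->
  (forall f, continuous f ->
    (fun mu : invariant_measure T => \int[mu]_x f x) @ U --> \int[nu]_x f x) ->
  U --> nu.
Proof.
move=> FU Unu.
have ptw : integrate_continuous (T := T) @ U --> integrate_continuous nu.
  (* Pointwise convergence is checked at each coordinate [i]; [cvg_image] asks that evaluation at
     [i] be onto, which constant functions show. *)
  apply/cvg_sup => i; apply/cvg_image.
    by rewrite eqEsubset; split=> // v _; exists (cst v).
  move=> W Wnu; exists (@^~ i @^-1` W).
    by case: i Wnu => f cf Wnu; exact: Unu cf W Wnu.
  by rewrite image_preimage// eqEsubset; split=> // v _; exists (cst v).
move=> A /= [_ [[B oB <-] Bnu BA]].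
have /ptw UB : nbhs (integrate_continuous nu) B by apply: open_nbhs_nbhs.
by rewrite nbhs_filterE; apply: filterS BA UB.
Qed.


Lemma weak_star_continuous f : continuous f ->
  continuous (fun mu : invariant_measure T => \int[mu]_x f x).
Proof.
move=> cf mu; pose i : {f : X -> R | continuous f} := exist _ f cf.
apply: (@continuous_comp _ _ _ (integrate_continuous (T := T))
  (fun g : {ptws {f : X -> R | continuous f} -> R} => g i) mu).
  exact: initial_continuous.
have /cvg_sup/(_ i)/cvg_image h :
    nbhs (integrate_continuous mu) --> integrate_continuous mu by exact: cvg_id.
apply: cvg_trans (h _).
  by move=> Q /= [W nbdW <-]; apply: filterS nbdW; exact: preimage_image.
by rewrite eqEsubset; split=> // v _; exists (cst v).
Qed.

(** Along an ultrafilter all values [mu B] converge, but the limit [m] is only finitely additive.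
    The limit measure is the probability [P] obtained by regularizing [m]; its invariance is first
    proved on open sets. *)
Lemma invariant_measure_compact : compact [set: invariant_measure T].
Proof.
rewrite compact_ultra => U UU _.
pose ev (B : set (borel X)) := fun mu : invariant_measure T => fine (mu B).
have ev_cvg B : measurable B -> exists2 l, ev B @ U --> l & 0 <= l <= 1.
  move=> mB; apply: ultra_bounded_cvg => mu; exact: fine_probability_bounds.
pose m (B : set (borel X)) := lim (ev B @ U).
have evm B : measurable B -> ev B @ U --> m B.
  move=> mB; have [l evl _] := ev_cvg B mB.
  by rewrite /m (cvg_lim _ evl).
have m_uniq B l : ev B @ U --> l -> m B = l.
  by move=> evl; rewrite /m (cvg_lim _ evl).
have m_ge0 B : measurable B -> 0 <= m B.
  by move=> mB; have [l /m_uniq -> /andP[]] := ev_cvg B mB.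
have m_add (E F : set (borel X)) : measurable E -> measurable F -> E `&` F = set0 ->
    m (E `|` F) = m E + m F.
  move=> mE mF EF; apply: m_uniq.
  rewrite (_ : ev _ = fun mu => ev E mu + ev F mu).
    by apply: cvgD; exact: evm.
  apply/funext => mu; rewrite /ev -fineD; [|exact: fin_num_measure..].
  by rewrite measureU.
have m1 : m setT = 1.
  apply: m_uniq; rewrite (_ : ev _ = cst 1); first exact: cvg_cst.
  by apply/funext => mu; rewrite /ev /= probability_setT.
have [P [PU mP]] := content_to_probability hX m_ge0 m_add m1.
have PT : forall B : set (borel X), measurable B -> P (T @^-1` B) = P B.
  have mT (K : set X) : closed K -> m (T @^-1` K) = m K.
    move=> cK; apply: m_uniq; rewrite (_ : ev _ = ev K).
      by apply: evm; exact: closed_borel.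
    apply/funext => mu; rewrite /ev im_invariant//; exact: closed_borel.
  have clT (K : set X) : closed K -> closed (T @^-1` K).
    by apply: closed_comp => x _; exact: hT.
  apply: pushforward_eq_on_open => // V oV.
  have oTV : open (T @^-1` V) by apply: open_comp => // x _; exact: hT.
  (* For closed [K] inside [T @^-1] V[, the compact image]T @[K] lies in [V] and its preimage
     contains [K]. For closed [K] inside [V], the preimage of [K] is a closed competitor of the same
     content. *)
  rewrite !PU//; apply/eqP; rewrite eq_le; apply/andP; split.
    apply: ge_ereal_sup => _ [K [cK KV] <-].
    have cTK : closed (T @` K).
      apply: compact_closed; first exact: metric_hausdorff.
      apply: continuous_compact; first exact: continuous_subspaceT.
      exact: subclosed_compact cK hX _.
    apply: (@le_trans _ _ (m (T @` K))%:E).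
      rewrite lee_fin -(mT (T @` K))//; apply: (content_le m_ge0 m_add).
      - exact: closed_borel.
      - by apply: closed_borel; exact: clT.
      - by move=> x Kx /=; exists x.
    by apply: le_inner_content => // _ [x /KV ? <-].
  apply: ge_ereal_sup => _ [K [cK KV] <-]; rewrite -(mT K)//.
  by apply: le_inner_content; [exact: clT|move=> x /KV].
pose nu := InvariantMeasure PT.
exists nu; split=> //=; apply: weak_star_cvg.
apply: (ultra_integral_cvg hX) => K cK l /m_uniq <-.
rewrite -lee_fin fineK; first exact: mP.
by apply: fin_num_measure; exact: closed_borel.
Qed.

End WeakStarCompactness.

(** * Entropy of mixtures *)

(** The limit is the infimum of the ratios. Dividing [n] by a [k.+1] whose ratio is nearly optimal,
    the full blocks cost at most that ratio per step and the remainder costs a bounded amount. *)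
Lemma fekete {R : realType} (u : nat -> R) : (forall n, 0 <= u n) ->
  (forall m n, u (m + n)%N <= u m + u n) ->
  cvgn (fun n => u n / n%:R).
Proof.
move=> u0 uD; pose S := [set u n.+1 / n.+1%:R | n in [set: nat]].
have S0 : S !=set0 by exists (u 1%N / 1); exists 0%N.
have lbS : lbound S 0 by move=> _ [n _ <-]; rewrite divr_ge0.
have hS : has_inf S by split => //; exists 0.
have umul q k r : u (q * k + r)%N <= q%:R * u k + u r.
  elim: q => [|q IH]; first by rewrite mul0n add0n mul0r add0r.
  by rewrite mulSn -addnA -natr1; have := uD k (q * k + r)%N; lra.
apply/cvg_ex; exists (inf S); apply/cvgrPdist_lt => e e0.
have e2 : 0 < e / 2 by rewrite divr_gt0.
have [_ [k _ <-] hk] := inf_adherent e2 hS.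
(* A bound, independent of [n], for [u] at every remainder modulo [k.+1]. *)
pose M := \sum_(r < k.+1) u r.
have M0 : 0 <= M by apply: sumr_ge0 => r _.
have uM r : (r < k.+1)%N -> u r <= M.
  move=> rk; rewrite /M (bigD1 (Ordinal rk))//= lerDl.
  by apply: sumr_ge0 => i _.
near=> n.
have n0 : (0 < n)%N by near: n; exists 1%N.
have n0R : 0 < n%:R :> R by rewrite ltr0n.
have Sn : inf S <= u n / n%:R.
  by apply: ge_inf; [exists 0|exists n.-1 => //; rewrite prednK].
rewrite distrC ger0_norm ?subr_ge0// ltrBlDl.
have Mn : M / n%:R < e / 2.
  rewrite ltr_pdivrMr// mulrC -ltr_pdivrMr//.
  near: n; exists (Num.bound (M / (e / 2))).+1 => // n /= hn.
  apply: lt_trans (archi_boundP _) _; first by rewrite divr_ge0// ltW.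
  by rewrite ltr_nat.
apply: (@le_lt_trans _ _ (u k.+1 / k.+1%:R + M / n%:R)); last first.
  by rewrite [e]splitr addrA ltrD.
rewrite ler_pdivrMr// mulrDl divfK ?gt_eqF//.
rewrite {1}(divn_eq n k.+1); apply: le_trans (umul _ _ _) _.
apply: lerD; last by apply: uM; rewrite ltn_mod.
rewrite mulrAC -[leRHS]mulrA mulrC ler_wpM2l//.
by rewrite ler_pdivlMr// -natrM ler_nat leq_trunc_div.
Unshelve. all: by end_near. Qed.

(** * Entropy inequalities for finite probability vectors *)

Section FiniteEntropy.
Context {R : realType}.

Lemma ln_le_subr1 (x : R) : 0 < x -> ln x <= x - 1.
Proof.
move=> x0; rewrite -{1}[x](subrK 1) addrC; apply: le_ln1Dx.
by rewrite -subr_gt0 opprK subrK.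
Qed.

(** This is [ln x <= x - 1] at [x = a * b / p], multiplied by [p]. The bounds [p <= a] and [p <= b]
    make [a] and [b] positive as soon as [p] is. *)
Lemma gibbs_term (p a b : R) : 0 <= p -> p <= a -> p <= b ->
  p * ln a + p * ln b - p * ln p <= a * b - p.
Proof.
move=> p_ge0 pa pb; have ab_ge0 : 0 <= a * b.
  by rewrite mulr_ge0// (le_trans p_ge0).
move: p_ge0; rewrite le_eqVlt => /predU1P[<-|p0].
  by rewrite !mul0r addr0 !subr0.
have a0 : 0 < a by exact: lt_le_trans pa.
have b0 : 0 < b by exact: lt_le_trans pb.
have ab0 : 0 < a * b by rewrite mulr_gt0.
have := ln_le_subr1 (divr_gt0 ab0 p0).
rewrite ln_div ?posrE// lnM ?posrE// -(ler_pM2l p0) => h.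
by rewrite -mulrDr -mulrBr (le_trans h)// mulrBr mulr1 mulrCA divff ?gt_eqF// mulr1.
Qed.

(** The Gibbs inequality is summed over all pairs; its right-hand sides [a i * b j - p i j] have
    total zero. *)
Lemma entropy_product_le (I J : finType) (p : I -> J -> R) (a : I -> R)
    (b : J -> R) : (forall i j, 0 <= p i j) ->
  (forall i, \sum_j p i j = a i) -> (forall j, \sum_i p i j = b j) ->
  \sum_i a i = 1 ->
  - (\sum_i \sum_j p i j * ln (p i j)) <=
  - (\sum_i a i * ln (a i)) - \sum_j b j * ln (b j).
Proof.
move=> p0 pa pb a1.
have b1 : \sum_j b j = 1.
  by rewrite -a1; under eq_bigr do rewrite -pb; rewrite exchange_big/=;
    apply: eq_bigr => i _; rewrite pa.
have -> : \sum_i a i * ln (a i) = \sum_i \sum_j p i j * ln (a i).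
  by apply: eq_bigr => i _; rewrite -mulr_suml pa.
have -> : \sum_j b j * ln (b j) = \sum_i \sum_j p i j * ln (b j).
  by rewrite exchange_big/=; apply: eq_bigr => j _; rewrite -mulr_suml pb.
have : \sum_i \sum_j (p i j * ln (a i) + p i j * ln (b j) - p i j * ln (p i j))
    <= \sum_i \sum_j (a i * b j - p i j).
  apply: ler_sum => i _; apply: ler_sum => j _; apply: gibbs_term => //.
    by rewrite -pa (bigD1 j)//= lerDl sumr_ge0.
  by rewrite -pb (bigD1 i)//= lerDl sumr_ge0.
have -> : \sum_i \sum_j (a i * b j - p i j) = 0.
  rewrite (eq_bigr (fun i => a i - a i)) => [|i _].
    by rewrite big1// => i _; rewrite subrr.
  by rewrite sumrB pa -mulr_sumr b1 mulr1.
under eq_bigr do rewrite sumrB big_split/=.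
by rewrite sumrB big_split/=; lra.
Qed.

Lemma xlnx_superadditive (x y : R) : 0 <= x -> 0 <= y ->
  x * ln x + y * ln y <= (x + y) * ln (x + y).
Proof.
have half (a b : R) : 0 <= a -> 0 <= b -> a * ln a <= a * ln (a + b).
  rewrite le_eqVlt => /predU1P[<- _|a0 b0]; first by rewrite !mul0r.
  by rewrite ler_pM2l// ler_ln ?posrE ?lerDl// ltr_wpDr.
by move=> x0 y0; rewrite mulrDl lerD ?half// addrC half.
Qed.

Lemma mulr_lnM (t a : R) : 0 < t -> 0 <= a ->
  (t * a) * ln (t * a) = t * (a * ln a) + (t * ln t) * a.
Proof.
move=> t0; rewrite le_eqVlt => /predU1P[<-|a0]; first by rewrite !(mulr0, mul0r) addr0.
by rewrite lnM ?posrE//; ring.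
Qed.

(** Concavity of Shannon entropy bounds a mixture from below; this is a converse bound. Its error
    [- (t * ln t + s * ln s)] depends neither on the vectors nor on the size of [I], so it
    disappears in entropy per unit of time. *)
Lemma entropy_mixture_le (I : finType) (a b : I -> R) (t s : R) :
  0 < t -> 0 < s -> (forall i, 0 <= a i) -> (forall i, 0 <= b i) ->
  \sum_i a i = 1 -> \sum_i b i = 1 ->
  - (\sum_i (t * a i + s * b i) * ln (t * a i + s * b i)) <=
  t * - (\sum_i a i * ln (a i)) + s * - (\sum_i b i * ln (b i))
  - (t * ln t + s * ln s).
Proof.
move=> t0 s0 a0 b0 a1 b1.
have : \sum_i ((t * a i) * ln (t * a i) + (s * b i) * ln (s * b i)) <=
    \sum_i (t * a i + s * b i) * ln (t * a i + s * b i).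
  by apply: ler_sum => i _; apply: xlnx_superadditive; rewrite mulr_ge0// ltW.
rewrite big_split/= (eq_bigr _ (fun i _ => mulr_lnM t0 (a0 i))).
rewrite [X in _ + X](eq_bigr _ (fun i _ => mulr_lnM s0 (b0 i))).
rewrite !big_split/= -!mulr_sumr a1 b1 !mulr1; lra.
Qed.

End FiniteEntropy.

Lemma fine_measure_partition d (T : measurableType d) {R : realType}
    (P : probability T R) (I : finType) (F : I -> set T) (E : set T) :
  measurable E -> (forall i, measurable (F i)) -> trivIset setT F ->
  \bigcup_i F i = setT ->
  \sum_i fine (P (E `&` F i)) = fine (P E).
Proof.
move=> mE mF tF cF; rewrite sum_fine; last first.
  by move=> i _; apply: fin_num_measure; exact: measurableI.
congr fine; rewrite -[E in RHS]setIT -cF setI_bigcupr.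
have -> : \bigcup_i (E `&` F i) = \bigcup_(i in [set` index_enum I]) (E `&` F i).
  congr (\bigcup_(i in _) _).
  by apply/seteqP; split=> i _ //=; rewrite mem_index_enum.
rewrite measure_fin_bigcup.
- by rewrite fsbig_seq ?index_enum_uniq.
- exact: finite_seq.
- apply: trivIset_setIl.
  by apply: sub_trivIset tF.
- by move=> i _; exact: measurableI.
Qed.

(** * Entropy of invariant measures: existence of the limit and convexity *)

Section DynamicalEntropy.
Context {R : realType} {X : pmetricType R}.
Variable T : X -> X.
Hypothesis hT : continuous T.
Implicit Types mu nu : invariant_measure T.

Lemma iter_preimage_measurable (B : set (borel X)) n :
  measurable B -> measurable ((iter n T @^-1` B) : set (borel X)).
Proof.
move=> mB; elim: n => [//|n IH].
rewrite -[X in measurable X]setTI.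
have -> : iter n.+1 T @^-1` B = T @^-1` (iter n T @^-1` B).
  by apply/funext => x; rewrite /preimage/= -iterSr.
exact: (continuous_borel_map hT).
Qed.

Lemma invariant_iter mu (B : set (borel X)) n :
  measurable B -> mu (iter n T @^-1` B) = mu B.
Proof.
move=> mB; elim: n => [//|n <-].
have -> : iter n.+1 T @^-1` B = T @^-1` (iter n T @^-1` B).
  by apply/funext => x; rewrite /preimage/= -iterSr.
by rewrite im_invariant//; exact: iter_preimage_measurable.
Qed.

Section Join.
Variables (k : nat) (C : 'I_k -> set (borel X)).
Hypothesis hC : is_partition C.

Let D n (w : {ffun 'I_n -> 'I_k}) : set (borel X) :=
  @dynamical_join R X T k C n w.

Lemma dynamical_join_measurable n w : measurable (@D n w).
Proof.
have [mC _ _] := hC.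
rewrite (_ : D w = \bigcap_(j in [set: 'I_n]) (iter j T @^-1` C (w j))).
  apply: fin_bigcap_measurable; first exact: finite_finset.
  by move=> j _; exact: iter_preimage_measurable.
by apply/seteqP; split=> x /= Dx; [move=> j _; exact: Dx|move=> j; exact: Dx].
Qed.

Lemma dynamical_join_trivIset n : trivIset setT (@D n).
Proof.
have [_ tC _] := hC.
move=> w w' _ _ [x [Dx D'x]]; apply/ffunP => j.
by apply: tC => //; exists (iter j T x); split; [exact: Dx|exact: D'x].
Qed.

Lemma dynamical_join_cover n : \bigcup_w @D n w = setT.
Proof.
have [_ _ cC] := hC; apply/seteqP; split=> // x _.
have /choice[c cP] (y : borel X) : exists i, C i y.
  by have : [set: borel X] y by []; rewrite -cC => -[i _ Ci]; exists i.
by exists [ffun j : 'I_n => c (iter j T x)] => // j; rewrite ffunE; exact: cP.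
Qed.

Definition word_cat n m (uv : {ffun 'I_n -> 'I_k} * {ffun 'I_m -> 'I_k}) :
    {ffun 'I_(n + m) -> 'I_k} :=
  [ffun i => match fintype.split i with inl j => uv.1 j | inr j => uv.2 j end].

Lemma word_cat_bij n m : bijective (@word_cat n m).
Proof.
exists (fun w : {ffun 'I_(n + m) -> 'I_k} =>
  ([ffun j : 'I_n => w (lshift m j)], [ffun j : 'I_m => w (rshift n j)])).
  move=> [u v]; congr pair; apply/ffunP => j; rewrite !ffunE.
    by rewrite -[lshift m j]/(unsplit (inl j)) unsplitK.
  by rewrite -[rshift n j]/(unsplit (inr j)) unsplitK.
move=> w; apply/ffunP => i; rewrite ffunE.
by case: split_ordP => j ->; rewrite /= ffunE.
Qed.

Lemma dynamical_join_cat n m (u : {ffun 'I_n -> 'I_k}) (v : {ffun 'I_m -> 'I_k}) :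
  D (word_cat (u, v)) = D u `&` (iter n T @^-1` D v).
Proof.
apply/seteqP; split=> x.
  move=> Dx; split=> j.
    have := Dx (lshift m j); rewrite ffunE.
    by rewrite -[lshift m j]/(unsplit (inl j)) unsplitK.
  have := Dx (rshift n j); rewrite ffunE.
  by rewrite -[rshift n j]/(unsplit (inr j)) unsplitK/= addnC iterD.
move=> [Du Dv] i; rewrite ffunE; case: split_ordP => j -> /=.
  exact: Du.
by rewrite addnC iterD; exact: Dv.
Qed.

Lemma join_probability_sum mu n : \sum_(w : {ffun 'I_n -> 'I_k}) fine (mu (D w)) = 1.
Proof.
have := @fine_measure_partition _ (borel X) R mu _ (@D n) setT measurableT
  (@dynamical_join_measurable n) (@dynamical_join_trivIset n)
  (@dynamical_join_cover n).
rewrite /= probability_setT/= => <-.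
by apply: eq_bigr => w _; rewrite setTI.
Qed.

Lemma partition_entropy_ge0 mu n : 0 <= partition_entropy mu (@D n).
Proof.
rewrite /partition_entropy -sumrN; apply: sumr_ge0 => w _.
have /andP[h0 h1] := fine_probability_bounds mu (dynamical_join_measurable w).
by rewrite -mulrN mulr_ge0// oppr_ge0 ln_le0.
Qed.

(** A cell for [n + m] is a cell for [n] intersected with the preimage under [iter n T] of a cell
    for [m]. Invariance gives the second marginal the measures of the cells for [m]. *)
Lemma partition_entropy_subadditive mu n m :
  partition_entropy mu (@D (n + m)) <=
  partition_entropy mu (@D n) + partition_entropy mu (@D m).
Proof.
have mD := dynamical_join_measurable.
rewrite /partition_entropy.
rewrite (reindex (@word_cat n m)); last exact/onW_bij/word_cat_bij.
rewrite -(pair_big xpredT xpredT (fun u v => fine (mu (D (word_cat (u, v)))) *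
  ln (fine (mu (D (word_cat (u, v)))))))/=.
apply: (entropy_product_le (p := fun u v => fine (mu (D (word_cat (u, v)))))).
- move=> u v; exact: (andP (fine_probability_bounds mu (mD _ _))).1.
- move=> u; under eq_bigr do rewrite dynamical_join_cat.
  apply: (@fine_measure_partition _ (borel X) R mu _
    (fun v => iter n T @^-1` D v)) => //.
  + by move=> v; exact: iter_preimage_measurable.
  + move=> v v' _ _ [x [h h']]; apply: dynamical_join_trivIset => //.
    by exists (iter n T x).
  + by rewrite -preimage_bigcup dynamical_join_cover preimage_setT.
- move=> v; rewrite -(invariant_iter mu n (mD _ v)).
  rewrite -(@fine_measure_partition _ (borel X) R mu _ (@D n)
    (iter n T @^-1` D v)) //.
  + by apply: eq_bigr => u _; rewrite dynamical_join_cat setIC.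
  + exact: iter_preimage_measurable.
  + exact: dynamical_join_trivIset.
  + exact: dynamical_join_cover.
- exact: join_probability_sum.
Qed.

Lemma entropy_wrt_cvg mu :
  cvgn (fun n : nat => partition_entropy mu (@D n) / n%:R).
Proof.
apply: fekete => [n|m n]; first exact: partition_entropy_ge0.
exact: partition_entropy_subadditive.
Qed.

(** The error [c] of the finite mixture bound is the same for all [n], and [c / n] tends to zero. *)
Lemma entropy_wrt_mixture nu mu1 mu2 (t s : R) : 0 < t -> 0 < s ->
  (forall B : set (borel X), measurable B ->
    fine (nu B) = t * fine (mu1 B) + s * fine (mu2 B)) ->
  entropy_wrt nu C <= t * entropy_wrt mu1 C + s * entropy_wrt mu2 C.
Proof.
move=> t0 s0 nuE; rewrite /entropy_wrt.
set c := - (t * ln t + s * ln s).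
pose H mu (n : nat) := partition_entropy mu (@D n) / n%:R.
have cH mu : H mu @ \oo --> limn (H mu) by exact: entropy_wrt_cvg.
have h : (fun n : nat => t * H mu1 n + s * H mu2 n + c * n%:R^-1) @ \oo -->
    t * limn (H mu1) + s * limn (H mu2) + c * 0.
  apply: cvgD; last first.
    apply: cvgM; first exact: cvg_cst.
    apply/(@gtr0_cvgV0 _ _ _ _ (fun n => n%:R)); last exact: cvgr_idn.
    by exists 1%N => // n /= n0; rewrite ltr0n.
  by apply: cvgD; apply: cvgM; solve [exact: cvg_cst|exact: cH].
rewrite -[leRHS]addr0 -[X in _ + X](mulr0 c).
apply: (ler_fmap_cvg (cH nu) h) => n.
(* The index [n = 0] needs no exception: the inverse of zero is zero, hence nonnegative. *)
rewrite /H !mulrA -!mulrDl ler_wpM2r ?invr_ge0//.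
have mD := @dynamical_join_measurable n.
rewrite {1}/partition_entropy (eq_bigr _ (fun w _ => congr1
  (fun z => z * ln z) (nuE _ (mD w)))).
apply: entropy_mixture_le => //; try exact: join_probability_sum.
- by move=> w; exact: (andP (fine_probability_bounds mu1 (mD _))).1.
- by move=> w; exact: (andP (fine_probability_bounds mu2 (mD _))).1.
Unshelve. all: by end_near. Qed.

End Join.

(** The partition with one cell gives a real lower bound; entropy is thus finite as soon as it is
    not [+oo]. *)
Lemma KS_entropy_gtNy mu : (-oo < KS_entropy mu)%E.
Proof.
pose C : 'I_1 -> set (borel X) := fun=> setT.
have pC : is_partition C.
  split=> [i|i j _ _ _|]; [exact: measurableT|by rewrite (ord1 i) (ord1 j)|].
  by rewrite /C bigcup_const//; exists ord0.
apply: (@lt_le_trans _ _ (entropy_wrt mu C)%:E); first exact: ltNyr.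
by apply: ereal_sup_ubound; exists 1%N, C.
Qed.

Lemma KS_entropy_mixture nu mu1 mu2 (t s : R) : 0 < t -> 0 < s ->
  (forall B : set (borel X), measurable B ->
    fine (nu B) = t * fine (mu1 B) + s * fine (mu2 B)) ->
  (KS_entropy nu <= t%:E * KS_entropy mu1 + s%:E * KS_entropy mu2)%E.
Proof.
move=> t0 s0 nuE; apply: ge_ereal_sup => _ [k [C [hC ->]]].
apply: (@le_trans _ _ (t * entropy_wrt mu1 C + s * entropy_wrt mu2 C)%:E).
  by rewrite lee_fin; exact: entropy_wrt_mixture.
rewrite EFinD !EFinM; apply: leeD; apply: lee_wpmul2l; rewrite ?lee_fin ?(ltW t0) ?(ltW s0)//.
- by apply: ereal_sup_ubound; exists k, C.
- by apply: ereal_sup_ubound; exists k, C.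
Qed.

End DynamicalEntropy.

(** * Supergradients of concave functions *)

Section RealFunctions.
Context {R : realType}.

(** Near [x] the difference quotient is within [1] of the derivative [l], hence the constant
    [|l| + 1]. One point of each pair stays at [x], which suffices at an endpoint. *)
Lemma derivable_locally_lipschitz (G : R -> R) (x : R) : derivable G x 1 ->
  exists C d, [/\ 0 <= C, 0 < d &
    forall y, `|y - x| < d -> `|G y - G x| <= C * `|y - x|].
Proof.
move=> /cvg_ex[/= l /cvgrPdist_lt /(_ 1 ltr01)].
move=> [d /= d0 h]; exists (`|l : R| + 1), d; split=> //.
move=> y yd; have [->|yx] := eqVneq y x; first by rewrite !subrr normr0 mulr0.
have yx0 : y - x != 0 by rewrite subr_eq0.
have := h (y - x); rewrite /= sub0r normrN => /(_ yd yx0).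
rewrite /GRing.scale/= mulr1 subrK => hl.
have -> : G y - G x = (y - x) * ((y - x)^-1 * (G y - G x)).
  by rewrite mulrA divff// mul1r.
rewrite normrM mulrC ler_wpM2r//.
rewrite -[X in `|X| <= _](subrK l) addrC (le_trans (ler_normD _ _))// lerD2l.
by rewrite distrC ltW.
Qed.

(** Convergence at [x + w] bounds [|a k| * w ^+ k] by some [M]. If [t = |y - x| / w] is at most one
    half, the terms after the first are dominated by a geometric series of sum at most
    [2 * M * t]. *)
Lemma power_series_locally_lipschitz (G : R -> R) (x : R) (a : nat -> R) (rho : R) :
  0 < rho ->
  (forall y, `|y - x| < rho ->
    series (fun k => a k * (y - x) ^+ k) @ \oo --> G y) ->
  exists C d, [/\ 0 <= C, 0 < d &
    forall y, `|y - x| < d -> `|G y - G x| <= C * `|y - x|].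
Proof.
move=> rho0 Ga; pose w := rho / 2.
have w0 : 0 < w by rewrite divr_gt0.
have wrho : `|x + w - x| < rho by rewrite addrAC subrr add0r gtr0_norm// /w; lra.
have [M M0 aM] : exists2 M, 0 <= M & forall k, `|a k| * w ^+ k <= M.
  have /cvg_series_bounded[N [_ hN]] :
      cvgn (series (fun k => a k * (x + w - x) ^+ k)).
    by apply/cvg_ex; exists (G (x + w)); exact: Ga.
  exists (`|N| + 1) => //.
  move=> k; have NN : N < `|N| + 1 by rewrite (le_lt_trans (ler_norm N))// ltrDl.
  have /= := hN (`|N| + 1) NN k I.
  by rewrite addrAC subrr add0r normrM normrX (gtr0_norm w0).
have Gx : G x = a 0%N.
  have xx : `|x - x| < rho by rewrite subrr normr0.
  have h := Ga x xx.
  apply: (cvg_unique _ h) => //.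
  apply: cvg_near_cst; exists 1%N => // -[//|n] _ /=.
  rewrite /series/= big_nat_recl//= expr0 mulr1 big1 ?addr0// => i _.
  by rewrite subrr expr0n/= mulr0.
exists (2 * M / w), (w / 2); split; [|by rewrite divr_gt0|].
  by rewrite divr_ge0 ?mulr_ge0// ltW.
move=> y yw; pose t := `|y - x| / w.
have t0 : 0 <= t by rewrite divr_ge0// ltW.
have t2 : t <= 2^-1 by rewrite /t ler_pdivrMr// mulrC ltW.
have yrho : `|y - x| < rho by rewrite (lt_trans yw)// /w; lra.
have term k : `|a k * (y - x) ^+ k| <= M * t ^+ k.
  rewrite normrM normrX.
  have -> : `|y - x| = t * w by rewrite /t divfK ?gt_eqF.
  by rewrite exprMn mulrCA [leRHS]mulrC ler_wpM2l ?exprn_ge0.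
(* The right-hand side is [M * t] times the sum of the first [n] powers of one half, since
   [t ^+ k.+1 <= t * 2^-1 ^+ k]. *)
have S n : `|series (fun k => a k * (y - x) ^+ k) n.+1 - a 0%N| <=
    M * t * (2 - 2 * (2^-1) ^+ n).
  elim: n => [|n IH].
    by rewrite /series/= big_nat1 expr0 mulr1 subrr normr0 expr0 mulr1 subrr mulr0.
  have -> : series (fun k => a k * (y - x) ^+ k) n.+2 - a 0%N =
      (series (fun k => a k * (y - x) ^+ k) n.+1 - a 0%N)
      + a n.+1 * (y - x) ^+ n.+1.
    by rewrite /series/= [in LHS]big_nat_recr//= addrAC.
  apply: le_trans (ler_normD _ _) _.
  have h2 : M * t ^+ n.+1 <= M * t * 2^-1 ^+ n.
    rewrite exprS mulrA ler_wpM2l ?(mulr_ge0 M0 t0)//.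
    by apply: lerXn2r => //; rewrite nnegrE ?invr_ge0.
  have -> : M * t * (2 - 2 * 2^-1 ^+ n.+1) =
      M * t * (2 - 2 * 2^-1 ^+ n) + M * t * 2^-1 ^+ n.
    by rewrite exprS; field.
  by apply: lerD => //; apply: le_trans (term _) h2.
have -> : 2 * M / w * `|y - x| = M * t * 2 by rewrite /t; field; rewrite gt_eqF.
rewrite Gx.
have hc : (fun n => `|series (fun k => a k * (y - x) ^+ k) n.+1 - a 0%N|) @ \oo
    --> `|G y - a 0%N|.
  apply: cvg_norm; apply: cvgB; last exact: cvg_cst.
  have := Ga y yrho.
  by rewrite -(cvg_shiftS (series (fun k => a k * (y - x) ^+ k))).
apply: (ler_fmap_cvg hc (cvg_cst _)) => n.
apply: le_trans (S n) _; rewrite ler_wpM2l ?(mulr_ge0 M0 t0)// gerBl.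
by rewrite mulr_ge0// exprn_ge0// invr_ge0.
Qed.

Lemma smooth_locally_lipschitz r (U : set R) (G : R -> R) (x : R) :
  at_least_two r -> smooth_on r U G -> U x ->
  exists C d, [/\ 0 <= C, 0 < d &
    forall y, `|y - x| < d -> `|G y - G x| <= C * `|y - x|].
Proof.
case: r => [n n2 [dG _] Ux|_ GU Ux|_ GU Ux].
- apply: derivable_locally_lipschitz; apply: (dG 0%N x _ Ux).
  exact: leq_trans n2.
- by apply: derivable_locally_lipschitz; exact: ((GU 1%N).1 0%N x isT Ux).
- have [a [rho [rho0 h]]] := GU x Ux.
  exact: power_series_locally_lipschitz rho0 h.
Qed.

(** * Chord inequalities for a concave function on an interval *)

Section Concave.
Variables (A B : R) (F : R -> R).
Hypothesis Fconc : concave_on_itv A B F.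

(** Concavity multiplied by [c - a]: free of division, and valid when points coincide. *)
Lemma concave_three_points a b c : A <= a -> a <= b -> b <= c -> c <= B ->
  (c - b) * F a + (b - a) * F c <= (c - a) * F b.
Proof.
move=> Aa ab bc cB; have [ac|ca] := eqVneq a c.
  have ba : b = a by apply/eqP; rewrite eq_le ab ac bc.
  by rewrite -ac ba !subrr !mul0r addr0.
have ac0 : 0 < c - a by rewrite subr_gt0 lt_neqAle ca (le_trans ab).
have t0 : 0 <= (c - b) / (c - a) by rewrite divr_ge0 ?(ltW ac0)// subr_ge0.
have t1 : (c - b) / (c - a) <= 1 by rewrite ler_pdivrMr// mul1r lerD2l lerN2.
have aI : a \in (`[A, B]%classic : set R).
  by rewrite inE/= in_itv/= Aa (le_trans ab)// (le_trans bc).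
have cI : c \in (`[A, B]%classic : set R).
  by rewrite inE/= in_itv/= cB (le_trans Aa)// (le_trans ab).
set u := (c - b) / (c - a) in t0 t1.
have h : - F (u * a + (1 - u) * c) <= u * - F a + (1 - u) * - F c.
  exact: (Fconc (Itv01 t0 t1) aI cI).
have ub : u * a + (1 - u) * c = b by rewrite /u; field; rewrite gt_eqF.
rewrite ub in h.
have -> : c - b = u * (c - a) by rewrite /u divfK ?gt_eqF.
have -> : b - a = (1 - u) * (c - a) by rewrite /u; field; rewrite gt_eqF.
have -> : u * (c - a) * F a + (1 - u) * (c - a) * F c =
  (c - a) * (u * F a + (1 - u) * F c) by ring.
by rewrite ler_pM2l//; lra.
Qed.

(** Chord slopes from [A] decrease, so a bound on the slopes near [A] propagates to the whole
    interval. *)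
Lemma concave_endpoint_bound C d : 0 < d -> A <= B ->
  (forall y, A <= y <= B -> `|y - A| < d -> `|F y - F A| <= C * `|y - A|) ->
  forall x, A <= x <= B -> F x <= F A + C * (x - A).
Proof.
move=> d0 AB h x /andP[]; rewrite le_eqVlt => /predU1P[<- _|Ax xB].
  by rewrite subrr mulr0 addr0.
(* This point lies beyond [A] by less than [d] and by no more than [x - A], whichever of the two is
   smaller. *)
pose y := A + (x - A) * d / (d + (x - A)).
have xA : 0 < x - A by rewrite subr_gt0.
have dxA : 0 < d + (x - A) by rewrite addr_gt0.
have yA : y - A = (x - A) * d / (d + (x - A)) by rewrite /y addrAC subrr add0r.
have yA0 : 0 < y - A by rewrite yA divr_gt0// mulr_gt0.
have yAd : y - A < d by rewrite yA ltr_pdivrMr// mulrC ltr_pM2l// ltrDr.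
have yx : y <= x.
  rewrite -(lerD2r (- A)) yA ler_pdivrMr// ler_wpM2l ?(ltW xA)// lerDl ltW//.
have Ay : A <= y by rewrite -subr_ge0 ltW.
have := h y; rewrite Ay (le_trans yx)// (gtr0_norm yA0) => /(_ isT yAd).
rewrite ler_norml => /andP[_ hy].
have h3 := concave_three_points (lexx A) Ay yx xB.
rewrite -(ler_pM2l yA0) -subr_ge0; nra.
Qed.

End Concave.

(** Carries the bound at the left endpoint over to the right one. *)
Lemma concave_reflect A B (F : R -> R) : concave_on_itv A B F ->
  concave_on_itv (- B) (- A) (F \o -%R).
Proof.
move=> Fc t x y xI yI.
have neg (z : R) : z \in (`[- B, - A]%classic : set R) -> - z \in (`[A, B]%classic : set R).
  by rewrite !inE/= !in_itv/= => /andP[? ?]; apply/andP; split; lra.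
have := Fc t (- x) (- y) (neg _ xI) (neg _ yI).
by rewrite /= (convN x y t).
Qed.

Definition lipschitz_bound A B C (F : R -> R) := forall x y, A <= x <= B -> A <= y <= B ->
  `|F x - F y| <= C * `|x - y|.

(** Slopes of a concave function are extreme at the endpoints: [C1] at [A] bounds them from above,
    and [- C2] at [B] from below. *)
Lemma concave_smooth_lipschitz r A B (F : R -> R) : A <= B -> at_least_two r ->
  concave_on_itv A B F -> smooth_on_itv r A B F ->
  exists2 C, 0 <= C & lipschitz_bound A B C F.
Proof.
move=> AB r2 Fc [d [G [d0 [GU GF]]]].
have GE x : A <= x <= B -> G x = F x by move=> xI; apply: GF; rewrite in_itv.
have IA : [set` `]A - d, B + d[] A.
  by rewrite /= in_itv/= ltrBlDr ltrDl d0/= (le_lt_trans AB)// ltrDl.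
have IB : [set` `]A - d, B + d[] B.
  by rewrite /= in_itv/= ltrDl d0 andbT ltrBlDr (le_lt_trans AB)// ltrDl.
have [C1 [d1 [C10 d10 h1]]] := smooth_locally_lipschitz r2 GU IA.
have [C2 [d2 [C20 d20 h2]]] := smooth_locally_lipschitz r2 GU IB.
have upA x : A <= x <= B -> F x <= F A + C1 * (x - A).
  apply: (concave_endpoint_bound Fc d10 AB) => y yI yd.
  by have := h1 y yd; rewrite !GE// lexx.
have upB x : A <= x <= B -> F x <= F B + C2 * (B - x).
  move=> /andP[Ax xB].
  have BA : - B <= - A by rewrite lerN2.
  have loc y : - B <= y <= - A -> `|y - - B| < d2 ->
      `|(F \o -%R) y - (F \o -%R) (- B)| <= C2 * `|y - - B|.
    move=> yI; rewrite /= opprK => yd; have yI' : A <= - y <= B by lra.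
    have yB : `|- y - B| = `|y + B| by rewrite -normrN; congr (`|_|); ring.
    by have := h2 (- y); rewrite yB !GE ?lexx ?AB//; exact.
  have xI : - B <= - x <= - A by lra.
  have := concave_endpoint_bound (concave_reflect Fc) d20 BA loc xI.
  rewrite /= !opprK; lra.
exists (Num.max C1 C2); first by rewrite le_max C10.
have C1m : C1 <= Num.max C1 C2 by rewrite le_max lexx.
have C2m : C2 <= Num.max C1 C2 by rewrite le_max lexx orbT.
have main x y : A <= x -> x < y -> y <= B ->
    `|F x - F y| <= Num.max C1 C2 * (y - x).
  move=> Ax xy yB; have xy0 : 0 < y - x by rewrite subr_gt0.
  have xI : A <= x <= B by rewrite Ax (le_trans _ yB)// ltW.
  have yI : A <= y <= B by rewrite yB andbT (le_trans Ax)// ltW.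
  rewrite ler_norml; apply/andP; split.
    suff : F y - F x <= C1 * (y - x).
      have := ler_wpM2r (ltW xy0) C1m; lra.
    have yA0 : 0 < y - A by lra.
    rewrite -(ler_pM2l yA0).
    have := concave_three_points Fc (lexx A) Ax (ltW xy) yB.
    have := ler_wpM2l (ltW xy0) (upA y yI); lra.
  suff : F x - F y <= C2 * (y - x).
    have := ler_wpM2r (ltW xy0) C2m; lra.
  have Bx0 : 0 < B - x by lra.
  rewrite -(ler_pM2l Bx0).
  have := concave_three_points Fc Ax (ltW xy) yB (lexx B).
  have := ler_wpM2l (ltW xy0) (upB x xI); lra.
move=> x y /andP[Ax xB] /andP[Ay yB].
have [xy|yx|->] := ltgtP x y.
- by rewrite [`|x - y|]distrC (gtr0_norm (_ : 0 < y - x)) ?subr_gt0// main.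
- by rewrite distrC (gtr0_norm (_ : 0 < x - y)) ?subr_gt0// main.
- by rewrite !subrr normr0 mulr0.
Qed.

(** An intermediate value argument for the supergradient, which may be multivalued: [S1] and [S2]
    collect the slopes admissible to the right and to the left of [z q]. *)
Lemma concave_lipschitz_fixed_slope A B C (F z : R -> R) : A <= B ->
  0 <= C -> concave_on_itv A B F -> lipschitz_bound A B C F ->
  continuous z -> (forall q, A <= z q <= B) ->
  exists q, forall x, A <= x <= B -> F x <= F (z q) + q * (x - z q).
Proof.
move=> AB C0 Fc Flip cz zI.
(* Projection onto [[A, B]]; composing with it extends [F] continuously to the line. *)
pose cl x := Num.max A (Num.min x B).
have clI x : A <= cl x <= B.
  by rewrite /cl le_max lexx/= ge_max AB/= ge_min lexx orbT.
have cl_id x : A <= x <= B -> cl x = x.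
  by move=> /andP[Ax xB]; rewrite /cl (min_idPl xB) (max_idPr Ax).
have cl_lip x y : `|cl x - cl y| <= `|x - y|.
  have h1 := ler_norm (x - y); have h2 := ler_norm (y - x).
  rewrite distrC in h2; rewrite ler_norml /cl.
  by case: (leP x B) => xB; case: (leP y B) => yB;
    rewrite ?(max_idPr AB); try case: (leP A x) => Ax; try case: (leP A y) => Ay;
    apply/andP; split; lra.
pose f x := F (cl x).
have cf : continuous f.
  have C1 : 0 < C + 1 by rewrite ltr_wpDl.
  move=> x; apply/cvgrPdist_lt => e e0; near=> y.
  apply: (@le_lt_trans _ _ (C * `|x - y|)).
    by apply: (le_trans (Flip _ _ (clI x) (clI y))); rewrite ler_wpM2l.
  apply: (@le_lt_trans _ _ ((C + 1) * `|x - y|)); first by rewrite ler_wpM2r// lerDl.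
  rewrite mulrC -ltr_pdivlMr//; near: y.
  by apply/nbhs_ballP; exists (e / (C + 1)) => //=; rewrite divr_gt0.
(* The maximum makes the condition vacuous when [x] is left of [z q]; for fixed [x] it remains
   continuous in [q], whence [S1] is closed. The minimum in [g2] does the same on the other side. *)
pose g1 x q := f (Num.max x (z q)) - f (z q) - q * (Num.max x (z q) - z q).
pose g2 x q := f (Num.min x (z q)) - f (z q) - q * (Num.min x (z q) - z q).
have cg1 x : continuous (g1 x).
  move=> q.
  have cm : Num.max x (z q') @[q' --> q] --> Num.max x (z q).
    exact: (continuous_max (cvg_cst x) (cz q)).
  have fm : f (Num.max x (z q')) @[q' --> q] --> f (Num.max x (z q)).
    by apply: continuous_cvg => //; exact: cf.
  have fz : f (z q') @[q' --> q] --> f (z q).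
    by apply: continuous_cvg; [exact: cf|exact: cz].
  exact: (cvgB (cvgB fm fz) (cvgM cvg_id (cvgB cm (cz q)))).
have cg2 x : continuous (g2 x).
  move=> q.
  have cm : Num.min x (z q') @[q' --> q] --> Num.min x (z q).
    exact: (continuous_min (cvg_cst x) (cz q)).
  have fm : f (Num.min x (z q')) @[q' --> q] --> f (Num.min x (z q)).
    by apply: continuous_cvg => //; exact: cf.
  have fz : f (z q') @[q' --> q] --> f (z q).
    by apply: continuous_cvg; [exact: cf|exact: cz].
  exact: (cvgB (cvgB fm fz) (cvgM cvg_id (cvgB cm (cz q)))).
pose S1 := \bigcap_(x in [set x | A <= x <= B]) [set q | g1 x q <= 0].
pose S2 := \bigcap_(x in [set x | A <= x <= B]) [set q | g2 x q <= 0].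
have clS (g : R -> R -> R) : (forall x, continuous (g x)) ->
    closed (\bigcap_(x in [set x | A <= x <= B]) [set q | g x q <= 0]).
  move=> cg; apply: closed_bigI => x _.
  by apply: (closed_comp (f := g x)) (@closed_le _ 0) => q _; exact: cg.
have clS1 : closed S1 by exact: clS.
have clS2 : closed S2 by exact: clS.
have [q [q1 q2]] : S1 `&` S2 !=set0.
  apply: contrapT => S12.
  (* Failures at [x1] to the right and [x2] to the left would put the chord from [x2] to [x1] above
     the graph at [z q]. *)
  have cover q : S1 q \/ S2 q.
    apply: contrapT => /not_orP[n1 n2].
    have [x1 x1I h1] : exists2 x, A <= x <= B & 0 < g1 x q.
      apply: contrapT => h; apply: n1 => x xI /=; rewrite leNgt; apply/negP => ?.
      by apply: h; exists x.
    have [x2 x2I h2] : exists2 x, A <= x <= B & 0 < g2 x q.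
      apply: contrapT => h; apply: n2 => x xI /=; rewrite leNgt; apply/negP => ?.
      by apply: h; exists x.
    have zx1 : z q < x1.
      rewrite ltNge; apply/negP => x1z; move: h1.
      by rewrite /g1 (max_idPr x1z) !subrr mulr0 subr0 ltxx.
    have x2z : x2 < z q.
      rewrite ltNge; apply/negP => zx2; move: h2.
      by rewrite /g2 (min_idPr zx2) !subrr mulr0 subr0 ltxx.
    move: h1 h2; rewrite /g1 /g2 (max_idPl (ltW zx1)) (min_idPl (ltW x2z)) /f.
    rewrite !cl_id// => h1 h2.
    have /andP[A2 _] := x2I; have /andP[_ B1] := x1I.
    have := concave_three_points Fc A2 (ltW x2z) (ltW zx1) B1; nra.
  have CS1 : S1 C.
    move=> x xI /=; rewrite /g1; have [xz|zx] := leP x (z C).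
      by rewrite !subrr mulr0 subr0.
    rewrite /f !cl_id//; have := Flip _ _ xI (zI C).
    rewrite (gtr0_norm (_ : 0 < x - z C)) ?subr_gt0// ler_norml; lra.
  have CS2 : S2 (- C).
    move=> x xI /=; rewrite /g2; have [xz|zx] := leP x (z (- C)); last first.
      by rewrite !subrr mulr0 subr0.
    rewrite /f !cl_id//; have := Flip _ _ xI (zI (- C)).
    rewrite distrC [`|x - _|]distrC (ger0_norm (_ : 0 <= z (- C) - x)) ?subr_ge0//.
    rewrite ler_norml; lra.
  have CC : - C <= C by lra.
  (* If [S1] and [S2] were disjoint, [S1] would be open and closed in the segment. Containing [C],
     it would contain [- C], which is in [S2]. *)
  have E : S1 `&` `[- C, C]%classic = `[- C, C]%classic.
    apply: (@segment_connected R (- C) C).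
    - by exists C; split=> //=; rewrite in_itv/= CC lexx.
    - exists (~` S2); first exact: closed_openC.
      rewrite setIC; apply/seteqP; split=> q [qI qS]; split=> //.
        by move=> qS2; apply: S12; exists q.
      by have [] := cover q.
    - by exists S1 => //; rewrite setIC.
  have : (`[- C, C]%classic : set R) (- C) by rewrite /= in_itv/= lexx CC.
  by rewrite -E => -[S1C _]; apply: S12; exists (- C).
exists q => x xI; have [xz|zx] := leP x (z q).
  have := q2 x xI; rewrite /= /g2 (min_idPl xz) /f !cl_id//; lra.
have := q1 x xI; rewrite /= /g1 (max_idPl (ltW zx)) /f !cl_id//; lra.
Unshelve. all: by end_near. Qed.

End RealFunctions.

(** * Equilibrium measures *)

Lemma ereal_sup_attained {R : realType} (I : Type) (f : I -> \bar R) (i : I) :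
  f i = ereal_sup [set f j | j in [set: I]] <-> forall j, (f j <= f i)%E.
Proof.
split=> [-> j|fi]; first by apply: ereal_sup_ubound; exists j.
apply/eqP; rewrite eq_le; apply/andP; split.
  by apply: ereal_sup_ubound; exists i.
by apply: ge_ereal_sup => _ [j _ <-].
Qed.

(** Adding [C] makes the integrand nonnegative, where additivity of the integral in the measure
    applies. *)
Lemma Rintegral_mixture d (T : measurableType d) {R : realType}
    (P P1 P2 : probability T R) (t s : R) (f : T -> R) (C : R) :
  0 <= t -> 0 <= s -> measurable_fun setT f -> (forall x, `|f x| <= C) ->
  (forall A, measurable A -> fine (P A) = t * fine (P1 A) + s * fine (P2 A)) ->
  \int[P]_x f x = t * \int[P1]_x f x + s * \int[P2]_x f x.
Proof.
move=> t0 s0 mf fC PE.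
have integ (Q : probability T R) : Q.-integrable setT (EFin \o f).
  exact: bounded_integrable mf fC.
have icst (Q : probability T R) : Q.-integrable setT (EFin \o (cst C : T -> R)).
  exact: finite_measure_integrable_cst.
have f0 x : 0 <= f x + C by have := fC x; rewrite ler_norml; lra.
have mfC : measurable_fun setT (fun x => f x + C) by apply: measurable_funD.
have mE : measurable_fun setT (EFin \o (fun x => f x + C)) by exact/measurable_EFinP.
have shift (Q : probability T R) :
    (\int[Q]_x (f x + C)%:E = (\int[Q]_x f x + C)%R%:E)%E.
  rewrite -[X in (_ + X)%:E](Rintegral_cst_probability Q)
    -(RintegralD _ (integ Q) (icst Q))//.
  rewrite /Rintegral fineK//; apply: integrable_fin_num => //.
  exact: (integrableD _ (integ Q) (icst Q)).
have : (\int[P]_x (f x + C)%:E = t%:E * \int[P1]_x (f x + C)%:E +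
    s%:E * \int[P2]_x (f x + C)%:E)%E.
  pose t' := NngNum t0; pose s' := NngNum s0.
  rewrite -(@ge0_integral_mscale _ _ _ P1 _ measurableT t')//; last first.
    by move=> x _; rewrite lee_fin.
  rewrite -(@ge0_integral_mscale _ _ _ P2 _ measurableT s')//; last first.
    by move=> x _; rewrite lee_fin.
  rewrite -ge0_integral_measure_add//; last by move=> x _; rewrite lee_fin.
  apply: eq_measure_integral => A mA _.
  rewrite [RHS]measure_addE /= /mscale/= -[LHS]fineK ?fin_num_measure//.
  rewrite -[P1 A]fineK ?fin_num_measure// -[P2 A]fineK ?fin_num_measure//.
  by rewrite -!EFinM -EFinD PE.
(* The whole space gives [t + s = 1], so the added constants cancel. *)
rewrite !shift -!EFinM -EFinD => -[]; have := PE setT measurableT.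
rewrite !probability_setT/= !mulr1 => ts.
have CE : C = t * C + s * C by rewrite -mulrDl -ts mul1r.
rewrite !mulrDr; lra.
Qed.

Section Equilibria.
Context {R : realType} {X : pmetricType R}.
Variables (T : X -> X) (phi : X -> R).
Hypothesis hX : compact [set: X].
Hypothesis hT : continuous T.
Hypothesis hphi : continuous phi.
Implicit Types mu nu : invariant_measure T.

Local Notation h := (@KS_entropy R X T).
Local Notation I mu := (\int[im_measure mu]_x phi x).

(** The normalized restriction to [B]; as [B] is its own preimage, intersecting with [B] commutes
    with taking preimages. *)
Lemma conditional_invariant nu (B : set (borel X)) : measurable B ->
  T @^-1` B = B -> 0 < fine (nu B) ->
  exists mu : invariant_measure T, forall A : set (borel X), measurable A ->
    fine (mu A) = (fine (nu B))^-1 * fine (nu (A `&` B)).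
Proof.
move=> mB TB nuB; have c0 : 0 <= (fine (nu B))^-1 by rewrite invr_ge0 ltW.
pose Q : {measure set (borel X) -> \bar R} :=
  mscale (NngNum c0) (mrestr nu mB).
have QE (A : set (borel X)) : Q A = ((fine (nu B))^-1%:E * nu (A `&` B))%E by [].
have Q1 : Q setT = 1%E.
  rewrite QE setTI -[X in (_ * X)%E]fineK ?fin_num_measure//.
  by rewrite -EFinM mulVf// gt_eqF.
pose P : probability (borel X) R := HB.pack (Q : set _ -> _) Q
  (Measure_isProbability.Build _ _ _ Q Q1).
have PE (A : set (borel X)) : P A = ((fine (nu B))^-1%:E * nu (A `&` B))%E by [].
have Pinv (A : set (borel X)) : measurable A -> P (T @^-1` A) = P A.
  move=> mA; rewrite !PE.
  have -> : T @^-1` A `&` B = T @^-1` (A `&` B) by rewrite preimage_setI TB.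
  rewrite im_invariant//.
  exact: measurableI.
exists (InvariantMeasure Pinv) => A mA.
rewrite -[LHS]/(fine ((fine (nu B))^-1%:E * nu (A `&` B))%E).
rewrite -[X in (_ * X)%E]fineK; last first.
  by apply: fin_num_measure; exact: measurableI.
by rewrite -EFinM.
Qed.

(** The summand [0] matches the form [a * phi + b] in [regular_pair]. *)
Lemma equilibrium_bound q nu :
  classical_equilibrium (fun x => q * phi x + 0) nu <->
  forall mu, (h mu + (q * I mu)%:E <= h nu + (q * I nu)%:E)%E.
Proof.
have E mu : \int[mu]_x (q * phi x + 0) = q * I mu.
  under eq_Rintegral do rewrite addr0.
  by rewrite RintegralZl//; exact: continuous_integrable.
rewrite /classical_equilibrium (@ereal_sup_attained R _ (fun mu =>
  (h mu + (\int[mu]_x (q * phi x + 0))%:E)%E) nu).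
by split=> H mu; have := H mu; rewrite !E.
Qed.

(** If [0 < nu B < 1], then [nu] mixes its conditional measures on [B] and on the complement. By
    convexity one of them does at least as well as [nu], so uniqueness equates it with [nu],
    although it gives [B] measure one or zero. *)
Lemma unique_equilibrium_ergodic q nu :
  (forall mu, (h mu + (q * I mu)%:E <= h nu + (q * I nu)%:E)%E) ->
  (forall nu', (forall mu, (h mu + (q * I mu)%:E <= h nu' + (q * I nu')%:E)%E) ->
    same_measure nu' nu) ->
  ergodic nu.
Proof.
move=> nu_max nu_uniq B mB TB.
have mCB : measurable (~` B) by exact: measurableC.
have TCB : T @^-1` (~` B) = ~` B by rewrite -[in RHS]TB.
have nuBf : nu B \is a fin_num by exact: fin_num_measure.
have nuC : fine (nu (~` B)) = 1 - fine (nu B).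
  by rewrite probability_setC// fineB.
have /andP[] := fine_probability_bounds nu mB.
rewrite le_eqVlt => /predU1P[B0 _|t0].
  by left; rewrite -[LHS]fineK// -B0.
rewrite le_eqVlt => /predU1P[B1|t1].
  by right; rewrite -[LHS]fineK// B1.
set t := fine (nu B) in t0 t1 nuC *; pose s := 1 - t.
have s0 : 0 < s by rewrite subr_gt0.
have [nu1 nu1E] := conditional_invariant mB TB t0.
have [nu2 nu2E] : exists mu : invariant_measure T,
    forall A : set (borel X), measurable A ->
    fine (mu A) = s^-1 * fine (nu (A `&` ~` B)).
  have := @conditional_invariant nu (~` B) mCB TCB.
  by rewrite nuC; exact.
have mix (A : set (borel X)) : measurable A ->
    fine (nu A) = t * fine (nu1 A) + s * fine (nu2 A).
  move=> mA; rewrite nu1E// nu2E// !mulrA !divff ?gt_eqF// !mul1r.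
  have mI (C : set (borel X)) : measurable C -> measurable (A `&` C).
    exact: measurableI.
  rewrite -fineD; [|by apply: fin_num_measure; exact: mI..].
  congr fine; rewrite -measureU; [|exact: mI..|].
    by rewrite -setIUr setUv setIT.
  by rewrite setIACA setICr setI0.
have hmix := KS_entropy_mixture hT t0 s0 mix.
have [C _ phiC] := continuous_bounded hX hphi.
have Imix : I nu = t * I nu1 + s * I nu2.
  exact: (Rintegral_mixture (ltW t0) (ltW s0) (continuous_borel_fun hphi) phiC mix).
have [e1|e1] := leP (h nu + (q * I nu)%:E)%E (h nu1 + (q * I nu1)%:E)%E.
  have : same_measure nu1 nu.
    by apply: nu_uniq => mu; exact: le_trans (nu_max mu) e1.
  move=> /(_ B mB) nu1B; right; rewrite -nu1B -[LHS]fineK ?fin_num_measure//.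
  by rewrite nu1E// setIid mulVf// gt_eqF.
have [e2|e2] := leP (h nu + (q * I nu)%:E)%E (h nu2 + (q * I nu2)%:E)%E.
  have : same_measure nu2 nu.
    by apply: nu_uniq => mu; exact: le_trans (nu_max mu) e2.
  move=> /(_ B mB) nu2B; left; rewrite -nu2B -[LHS]fineK ?fin_num_measure//.
  by rewrite nu2E// setICr measure0 mulr0.
exfalso.
(* A strictly smaller value cannot come from infinite entropy. Both conditional entropies are thus
   real, and so is that of [nu] by [hmix]. *)
have hfin mu : (h mu + (q * I mu)%:E < h nu + (q * I nu)%:E)%E ->
    h mu \is a fin_num.
  move=> lt_mu; apply: fin_real; rewrite KS_entropy_gtNy/= ltey.
  by apply: contraTneq lt_mu => ->; rewrite addye// -leNgt leey.
have h_nu : h nu \is a fin_num.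
  apply: fin_real; rewrite KS_entropy_gtNy/= (le_lt_trans hmix)//.
  by rewrite -(fineK (hfin _ e1)) -(fineK (hfin _ e2)) -!EFinM -EFinD ltry.
move: (e1) (e2) hmix.
rewrite -(fineK (hfin _ e1)) -(fineK (hfin _ e2)) -(fineK h_nu).
set h1 := fine (h nu1); set h2 := fine (h nu2); set h0 := fine (h nu).
rewrite -!EFinM -!EFinD !lte_fin lee_fin Imix => {}e1 {}e2 e0.
have := mulr_gt0 t0 (_ : 0 < h0 + q * (t * I nu1 + s * I nu2) - (h1 + q * I nu1)).
have := mulr_gt0 s0 (_ : 0 < h0 + q * (t * I nu1 + s * I nu2) - (h2 + q * I nu2)).
rewrite !subr_gt0 => /(_ e2) g2 /(_ e1) g1.
move: g1 g2 e0; rewrite /s; lra.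
Qed.

(** Upper semicontinuity lets optimality pass to cluster points of the maximizers, and uniqueness
    identifies every such point. *)
Lemma equilibrium_integral_continuous (m : R -> invariant_measure T) :
  lower_semicontinuous (fun mu : invariant_measure T => - h mu)%E ->
  (forall mu, h mu \is a fin_num) ->
  (forall q mu, (h mu + (q * I mu)%:E <= h (m q) + (q * I (m q))%:E)%E) ->
  (forall q nu, (forall mu, (h mu + (q * I mu)%:E <= h nu + (q * I nu)%:E)%E) ->
    same_measure nu (m q)) ->
  continuous (fun q => I (m q)).
Proof.
move=> usc hfin m_max m_uniq q; apply/cvgrPdist_lt => e e0.
have [C C0 phiC] := continuous_bounded hX hphi.
have IC mu : `|I mu| <= C by exact: Rintegral_norm_le.
apply: contrapT => not_near.
(* Otherwise a weak* cluster point of the [m q'] with [I (m q')] far from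
   [I (m q)] is an equilibrium for [q]. *)
pose far := [set q' | ~ `|I (m q) - I (m q')| < e].
have far_nbhs V : nbhs q V -> exists2 q', V q' & far q'.
  move=> Vq; apply: contrapT => no; apply: not_near.
  apply: filterS Vq => q' Vq'; apply: contrapT => fq'.
  by apply: no; exists q'.
(* The restricted filter is proper because [far] meets every neighbourhood of [q]. *)
have FP : ProperFilter (within far (nbhs q)).
  apply: Build_ProperFilter_ex => V /far_nbhs[q' Vq' fq'].
  by exists q'; exact: Vq'.
have [|mu [_ clmu]] := invariant_measure_compact hX hT (F := m @ within far (nbhs q)) _.
  exact: filterT.
have Icont := weak_star_continuous (T := T) hphi.
have near_mu (N : set (invariant_measure T)) V : nbhs mu N -> nbhs q V ->
    exists q', [/\ V q', far q' & N (m q')].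
  move=> Nmu Vq.
  have FV : (m @ within far (nbhs q)) (m @` (V `&` far)).
    by rewrite /= /within/=; apply: filterS Vq => q' Vq' fq'; exists q'.
  have [nu [[q' [Vq' fq'] <-] Nq']] := clmu _ _ FV Nmu.
  by exists q'.
have mu_max nu : (h nu + (q * I nu)%:E <= h mu + (q * I mu)%:E)%E.
  have usc_mu := usc mu; move: (m_max^~ nu) usc_mu.
  rewrite -(fineK (hfin nu)) -(fineK (hfin mu)).
  set a := fine (h nu); set b := fine (h mu) => nu_le usc_mu.
  rewrite -!EFinD lee_fin leNgt; apply/negP => lt_mu.
  (* The supposed gap. Entropy, the integral of [phi] and the slope each cost at most [g / 4], which
     fixes [dl] and [dq]; [|q| + 1] avoids a division by zero. *)
  pose g := a + q * I nu - (b + q * I mu).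
  have g0 : 0 < g by rewrite subr_gt0.
  have [|N Nmu Nusc] := usc_mu (- (b + g / 4)).
    by rewrite -EFinN lte_fin ltrN2 ltrDl divr_gt0.
  pose dl := g / (4 * (`|q| + 1)).
  have q1 : 0 < `|q| + 1 by rewrite ltr_wpDl.
  have dl0 : 0 < dl by rewrite divr_gt0// mulr_gt0.
  pose dq := g / (8 * C).
  have dq0 : 0 < dq by rewrite divr_gt0// mulr_gt0.
  have NI : nbhs mu [set mu' | `|I mu - I mu'| < dl].
    exact: (Icont mu _ (nbhsx_ballx (I mu) dl dl0)).
  have [q' [Vq' _ [/Nusc Nq' Iq']]] := near_mu _ _ (filterI Nmu NI)
    (nbhsx_ballx q dq dq0).
  have := nu_le q'; move: Nq'; rewrite -(fineK (hfin (m q'))).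
  set c := fine (h (m q')).
  rewrite -EFinN lte_fin ltrN2 -!EFinD lee_fin => cb ac.
  rewrite /= in Iq'; rewrite /ball/= in Vq'.
  have b1 : `|(q - q') * (I nu - I (m q'))| <= dq * (2 * C).
    rewrite normrM ler_pM ?(ltW Vq')//.
    apply: le_trans (ler_normB _ _) _.
    by have := IC nu; have := IC (m q'); lra.
  have b2 : `|q * (I mu - I (m q'))| <= g / 4.
    rewrite normrM; apply: (@le_trans _ _ ((`|q| + 1) * dl)).
      by rewrite ler_pM ?(ltW Iq')// lerDl.
    by rewrite /dl le_eqVlt; apply/orP; left; apply/eqP; field; rewrite gt_eqF.
  have b3 : dq * (2 * C) = g / 4 by rewrite /dq; field; rewrite gt_eqF.
  move: b1 b2; rewrite b3 !ler_norml; rewrite /g in cb *; nra.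
(* [same_measure] suffices, since an integral sees a measure only through measurable sets. *)
have muq : I mu = I (m q).
  congr fine; apply: eq_measure_integral => A mA _.
  exact: m_uniq mu_max A mA.
have [q' [_ far_q' near_q']] := near_mu _ _
  (Icont mu _ (nbhsx_ballx (I mu) e e0)) (@filterT _ _ (nbhs_filter q)).
by apply: far_q'; rewrite -muq.
Qed.

End Equilibria.

(** * The nonlinear variational problem *)

Theorem theorem9 (R : realType) (X : pmetricType R) (T : X -> X)
    (phi : X -> R) (r : smoothness) (A B : R) (F : R -> R)
    (hX : compact [set: X])
    (hT : continuous T)
    (hphi : continuous phi)
    (hr : at_least_two r)
    (hreg : regular_pair T r phi)
    (hA : A = inf (integral_range T phi))
    (hB : B = sup (integral_range T phi))
    (hFconcave : concave_on_itv A B F)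
    (hFsmooth : smooth_on_itv r A B F) :
  exists nu : invariant_measure T,
    [/\ nonlinear_equilibrium F phi nu,
        forall nu' : invariant_measure T,
          nonlinear_equilibrium F phi nu' -> same_measure nu' nu
      & ergodic nu].
Proof.
have [equil _ usc] := hreg.
pose h (mu : invariant_measure T) := KS_entropy mu.
pose J (mu : invariant_measure T) := \int[mu]_x phi x.
have /choice[m mP] q : exists nu : invariant_measure T,
    (forall mu, (h mu + (q * J mu)%:E <= h nu + (q * J nu)%:E)%E) /\
    forall nu', (forall mu, (h mu + (q * J mu)%:E <= h nu' + (q * J nu')%:E)%E) ->
      same_measure nu' nu.
  have [nu [/(equilibrium_bound hX hphi) nu_max nu_uniq]] := equil q 0.
  exists nu; split=> // nu' nu'_max; apply: nu_uniq.
  exact/(equilibrium_bound hX hphi).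
have m_max q := (mP q).1; have m_uniq q := (mP q).2.
have NL nu : nonlinear_equilibrium F phi nu <->
    forall mu, (h mu + (F (J mu))%:E <= h nu + (F (J nu))%:E)%E.
  exact: (@ereal_sup_attained R _ (fun mu => (h mu + (F (J mu))%:E)%E) nu).
(* One slope [q] serves both claims: [m q] solves the nonlinear problem, and every nonlinear
   solution solves the classical problem of slope [q]. *)
have [q [nu_max nu_eq]] : exists q,
    (forall mu, (h mu + (F (J mu))%:E <= h (m q) + (F (J (m q)))%:E)%E) /\
    forall nu, (forall mu, (h mu + (F (J mu))%:E <= h nu + (F (J nu))%:E)%E) ->
      forall mu, (h mu + (q * J mu)%:E <= h nu + (q * J nu)%:E)%E.
  (* If some measure has infinite entropy, it is the only equilibrium of every
     problem. *)
  have [[nu0 nu0y]|hfin] := pselect (exists nu, h nu = +oo%E).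
    have m0 : h (m 0) = +oo%E.
      by have := m_max 0 nu0; rewrite nu0y !mul0r !adde0 leye_eq => /eqP.
    exists 0; split=> [mu|nu nu_max mu]; first by rewrite m0 addye// leey.
    have /eqP nuy : h nu + (F (J nu))%:E == +oo%E.
      by rewrite -leye_eq (le_trans _ (nu_max nu0))// nu0y addye.
    have -> : h nu = +oo%E.
      by move: nuy; case: (h nu).
    by rewrite addye// leey.
  have {}hfin mu : h mu \is a fin_num.
    apply: fin_real; rewrite KS_entropy_gtNy/= ltey.
    by apply/eqP => hy; apply: hfin; exists mu.
  have [C C0 phiC] := continuous_bounded hX hphi.
  have JC mu : `|J mu| <= C by exact: Rintegral_norm_le.
  have range0 : integral_range T phi !=set0 by exists (J (m 0)), (m 0).
  have JI mu : A <= J mu <= B.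
    have Jmu : integral_range T phi (J mu) by exists mu.
    rewrite hA hB; apply/andP; split.
      apply: ge_inf => //; exists (- C) => _ [mu' _ <-].
      by have := JC mu'; rewrite ler_norml => /andP[].
    apply: ub_le_sup => //; exists C => _ [mu' _ <-].
    by have := JC mu'; rewrite ler_norml => /andP[].
  have AB : A <= B by have /andP[/le_trans] := JI (m 0); apply.
  have [K K0 Flip] := concave_smooth_lipschitz AB hr hFconcave hFsmooth.
  have cz : continuous (fun q => J (m q)).
    exact: equilibrium_integral_continuous.
  have [q Fq] := concave_lipschitz_fixed_slope AB K0 hFconcave Flip cz (fun q => JI (m q)).
  exists q; split=> [mu|nu nu_max mu].
    have := m_max q mu; have := Fq _ (JI mu).
    rewrite -(fineK (hfin mu)) -(fineK (hfin (m q))) -!EFinD !lee_fin; lra.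
  (* Optimality of [nu] against [m q] and the supergradient inequality at [J nu] show that [nu] does
     as well as [m q] in the classical problem. *)
  have := m_max q mu; have := Fq _ (JI nu); have := nu_max (m q).
  rewrite -(fineK (hfin mu)) -(fineK (hfin (m q))) -(fineK (hfin nu)).
  rewrite -!EFinD !lee_fin; lra.
exists (m q); split.
- exact/NL.
- by move=> nu' /NL nu'_max; apply: m_uniq; exact: nu_eq.
- exact: (unique_equilibrium_ergodic hX hT hphi (m_max q) (m_uniq q)).
Qed.
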